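(* Let $S \subsetneq \mathbb{Z}^2$. (a) If $S$ is B-stable, then $\overline{\delta}(S) \le 1/4$. Moreover, for every real $\delta$ with $0 \le \delta \le 1/4$ there exists a BI-stable set $S$ with $\overline{\delta}(S) = \delta$; for instance, every subset of $2\mathbb{Z}^2 = 2\mathbb{Z} \times 2\mathbb{Z}$ is BI-stable. (b) If $S$ is I-stable, then $\overline{\delta}(S) \le 1/2$. Moreover, for every real $\delta$ with $0 \le \delta \le 1/2$ there exists an I-stable set $S$ with $\overline{\delta}(S) = \delta$; for instance, every subset of $\mathbb{Z} \times 2\mathbb{Z}$ is I-stable.
   Context: A lattice triangle is the convex hull in $\mathbb{R}^2$ of three non-collinear points of $\mathbb{Z}^2$. A triangle is a set $T = \Delta \cap \mathbb{Z}^2$ for a lattice triangle $\Delta$; vertices, boundary and interior of $T$ are those of $\Delta$. A triangle is minimal if it contains exactly $4$ points of $\mathbb{Z}^2$; a minimal triangle is a border triangle if its non-vertex point lies on the boundary of $\Delta$, and an internal triangle if that point lies in the interior. A set $S \subseteq \mathbb{Z}^2$ is B-stable if no border triangle has exactly three of its points in $S$; I-stable if no internal triangle has exactly three of its points in $S$; BI-stable if it is both B-stable and I-stable. For $a\le b$ integers, $[a,b]$ denotes $\{i \in \mathbb{Z} : a \le i \le b\}$. The upper density of $X \subseteq \mathbb{Z}^2$ is $\overline{\delta}(X) = \limsup_{n\to\infty} |X \cap [-n,n]^2| / |[-n,n]^2|$. *)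

(* Defs.v *)
From HB Require Import structures.
From mathcomp Require Export all_boot all_order all_algebra finmap.
From mathcomp Require Export all_classical all_reals all_analysis.

Set Implicit Arguments.
Unset Strict Implicit.
Unset Printing Implicit Defensive.

Export Order.TTheory GRing.Theory Num.Theory.
Export numFieldNormedType.Exports.

Local Open Scope classical_set_scope.
Local Open Scope ring_scope.

Definition point : Type := (int * int)%type.

Definition embed (R : realType) (p : point) : R * R := (p.1%:~R, p.2%:~R).

Definition convex_hull (R : realType) (A : set (R * R)) : set (R * R) :=
  smallest (@convex_set R (R * R)%type) A.

Definition boundary (R : realType) (A : set (R * R)) : set (R * R) :=
  closure A `\` interior A.

(* All points of A lie on one line u x + v y = w. *)
Definition collinear (R : realType) (A : set (R * R)) : Prop :=
  exists u v w : R, (u, v) <> (0, 0) /\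
    A `<=` [set p | u * p.1 + v * p.2 = w].

Section Triangles.
Variable R : realType.

Definition real_vertices (a b c : point) : set (R * R) :=
  [set embed R a; embed R b; embed R c].

Definition lattice_triangle (a b c : point) : set (R * R) :=
  convex_hull (real_vertices a b c).

Definition triangle (a b c : point) : set point :=
  embed R @^-1` lattice_triangle a b c.

Definition minimal (a b c : point) : Prop :=
  ~ collinear (real_vertices a b c) /\ (triangle a b c #= `I_4)%card.

(* The equality with [set p] says that p is the non-vertex point. *)
Definition border_triangle (T : set point) : Prop :=
  exists a b c : point, [/\ minimal a b c, T = triangle a b c &
    exists2 p, T `\` [set a; b; c] = [set p] &
               boundary (lattice_triangle a b c) (embed R p)].

Definition internal_triangle (T : set point) : Prop :=
  exists a b c : point, [/\ minimal a b c, T = triangle a b c &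
    exists2 p, T `\` [set a; b; c] = [set p] &
               interior (lattice_triangle a b c) (embed R p)].

Definition B_stable (S : set point) : Prop :=
  forall T, border_triangle T -> ~ (T `&` S #= `I_3)%card.

Definition I_stable (S : set point) : Prop :=
  forall T, internal_triangle T -> ~ (T `&` S #= `I_3)%card.

Definition BI_stable (S : set point) : Prop := B_stable S /\ I_stable S.

Definition box (n : nat) : set point :=
  `[- n%:Z, n%:Z] `*` `[- n%:Z, n%:Z].

(* [fset_set A] has the elements of A only when A is finite, as here. *)
Definition upper_density (X : set point) : \bar R :=
  limn_esup (fun n => (#|` fset_set (X `&` box n)|%:R /
                       #|` fset_set (box n)|%:R)%:E).

End Triangles.

Definition evens : set int := [set 2 * k | k in [set: int]].

(* Main.v *)
Require Import Defs.
From mathcomp Require Import zify ring lra.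

Set Implicit Arguments.
Unset Strict Implicit.
Unset Printing Implicit Defensive.

Local Open Scope classical_set_scope.
Local Open Scope ring_scope.

(** Border triangles are the sets {u - v, u, u + v, u + w} and internal triangles
    the sets {u, u + v, u + w, u - v - w}, where v, w is a basis of Z^2.

    B-stable sets.  Filling in border triangles from a unimodular triangle yields
    all of Z^2.  Hence a proper B-stable set has no triangle of determinant 1 or 2
    and no three consecutive points on a lattice line, so a pair at primitive
    difference v empties the two neighbouring lines on either side of its line.
    Average over the unit squares: a square has at most two points, and when it has
    two they form a horizontal, vertical or diagonal pair.  A horizontal or
    vertical pair causes excess 2 and sends 1/3 to each of six nearby empty squares;
    a diagonal pair causes excess 1 and sends 1/2 to each of two empty squares.
    No empty square receives more than 1, so the average is at most 1.

    I-stable sets.  If a unit square has three points in S, then S contains a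
    unimodular triangle, and filling in internal triangles shows that S is
    4Z^2-periodic; an I-stable proper subset of (Z/4)^2 has at most 8 elements.
    Otherwise every unit square has at most two points.

    Examples.  Three points of 2Z^2 in a triangle have at least two lattice midpoints
    besides them, so a minimal triangle has at most two.  Among three points of
    Z x 2Z two are congruent mod 2; in an internal triangle their midpoint would be
    the centre, yet lie on an edge.  Prescribed densities come from Beatty sets
    {x : floor (alpha (x + 1)) <> floor (alpha x)}. *)

(** * Closure under border and internal triangles *)

Definition det2 (v1 v2 w1 w2 : int) : int := v1 * w2 - v2 * w1.

(** The vertices are [a], [c], [d], and the fourth point [b] is the midpoint of [a] and [c]. A
    boolean predicate on coordinates stands for the set, so that points can be counted and finite
    cases computed. *)
Definition border_closed (s : int -> int -> bool) :=
  forall a1 a2 b1 b2 c1 c2 d1 d2 : int,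
    a1 + c1 = 2 * b1 -> a2 + c2 = 2 * b2 ->
    `|det2 (c1 - b1) (c2 - b2) (d1 - b1) (d2 - b2)| = 1 ->
  (s a1 a2 + s b1 b2 + s c1 c2 + s d1 d2 != 3)%N.

(** Here [o] is the centroid of the vertices [a], [b], [c]. *)
Definition internal_closed (s : int -> int -> bool) :=
  forall o1 o2 a1 a2 b1 b2 c1 c2 : int,
    a1 + b1 + c1 = 3 * o1 -> a2 + b2 + c2 = 3 * o2 ->
    `|det2 (a1 - o1) (a2 - o2) (b1 - o1) (b2 - o2)| = 1 ->
  (s o1 o2 + s a1 a2 + s b1 b2 + s c1 c2 != 3)%N.

(** The set in affine coordinates with origin [(x, y)] and axes [v], [w]. For a unimodular basis
    both closure conditions survive, so arguments can start from the standard corner. *)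
Definition reparam (s : int -> int -> bool) (x y v1 v2 w1 w2 i j : int) :=
  s (x + i * v1 + j * w1) (y + i * v2 + j * w2).

Lemma det2_reparam (v1 v2 w1 w2 a1 a2 b1 b2 c1 c2 x y : int) :
  det2 ((x + a1 * v1 + a2 * w1) - (x + c1 * v1 + c2 * w1))
       ((y + a1 * v2 + a2 * w2) - (y + c1 * v2 + c2 * w2))
       ((x + b1 * v1 + b2 * w1) - (x + c1 * v1 + c2 * w1))
       ((y + b1 * v2 + b2 * w2) - (y + c1 * v2 + c2 * w2)) =
  det2 (a1 - c1) (a2 - c2) (b1 - c1) (b2 - c2) * det2 v1 v2 w1 w2.
Proof. by rewrite /det2; ring. Qed.

(** With [k = 2] or [k = 3] this carries the midpoint or centroid equation through the change of
    coordinates. *)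
Lemma reparam_linear (k x v w a1 a2 b1 b2 : int) :
  a1 = k * b1 -> a2 = k * b2 ->
  k * x + a1 * v + a2 * w = k * (x + b1 * v + b2 * w).
Proof. by move=> -> ->; ring. Qed.

Lemma border_closed_reparam s (x y v1 v2 w1 w2 : int) :
  `|det2 v1 v2 w1 w2| = 1 -> border_closed s ->
  border_closed (reparam s x y v1 v2 w1 w2).
Proof.
move=> vw bs a1 a2 b1 b2 c1 c2 d1 d2 e1 e2 e3.
apply: bs; rewrite ?det2_reparam ?normrM ?e3 ?vw ?mulr1 //;
  by rewrite -(reparam_linear _ _ _ e1 e2); ring.
Qed.

Lemma internal_closed_reparam s (x y v1 v2 w1 w2 : int) :
  `|det2 v1 v2 w1 w2| = 1 -> internal_closed s ->
  internal_closed (reparam s x y v1 v2 w1 w2).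
Proof.
move=> vw bs o1 o2 a1 a2 b1 b2 c1 c2 e1 e2 e3.
apply: bs; rewrite ?det2_reparam ?normrM ?e3 ?vw ?mulr1 //;
  by rewrite -(reparam_linear _ _ _ e1 e2); ring.
Qed.

(** Cramer's rule, where the determinant [D], being 1 or -1, is its own inverse. The offsets [i],
    [j] allow periods to be transferred along with points. *)
Lemma reparam_surj s (x y v1 v2 w1 w2 p q : int) :
  `|det2 v1 v2 w1 w2| = 1 ->
  {ij | forall i j, reparam s x y v1 v2 w1 w2 (ij.1 + i) (ij.2 + j) =
    s (p + (i * v1 + j * w1)) (q + (i * v2 + j * w2))}.
Proof.
set D := det2 v1 v2 w1 w2 => vw.
have DD : D * D = 1 by have [->|->] : D = 1 \/ D = -1 by lia.
exists (D * det2 (p - x) (q - y) w1 w2, D * det2 v1 v2 (p - x) (q - y)).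
move=> i j; rewrite /reparam; congr s => /=.
- transitivity (x + D * D * (p - x) + (i * v1 + j * w1)); last by rewrite DD; ring.
  by rewrite /D /det2; ring.
- transitivity (y + D * D * (q - y) + (i * v2 + j * w2)); last by rewrite DD; ring.
  by rewrite /D /det2; ring.
Qed.

Lemma int_step_ind (P : int -> Prop) :
  P 0 -> (forall i, P i -> P (i + 1)) -> (forall i, P i -> P (i - 1)) ->
  forall i, P i.
Proof.
move=> P0 PS PP; elim/int_ind => // n Pn; first by rewrite -addn1 PoszD; exact: PS.
by rewrite -addn1 PoszD opprD; exact: PP.
Qed.

Section BorderClosed.
Variable s : int -> int -> bool.
Hypothesis bs : border_closed s.

Let corner i j := [&& s i j, s (i + 1) j & s i (j + 1)].

(** Each new point completes a border triangle with three known points. The order matters: [RT] is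
    reached as the midpoint of [(i + 1, j)] and [RTT], and [RTT] comes from the diagonal through
    [L]. *)
Let corner_spread i j : corner i j ->
  [/\ corner (i + 1) j, corner (i - 1) j, corner i (j + 1) & corner i (j - 1)].
Proof.
case/and3P => s00 s10 s01.
have L : s (i - 1) j.
  by move: (@bs (i - 1) j i j (i + 1) j i (j + 1)); rewrite /det2 s00 s10 s01; lia.
have B : s i (j - 1).
  by move: (@bs i (j - 1) i j i (j + 1) (i + 1) j); rewrite /det2 s00 s10 s01; lia.
have RR : s (i + 2) j.
  by move: (@bs i j (i + 1) j (i + 2) j i (j + 1)); rewrite /det2 s00 s10 s01; lia.
have TT : s i (j + 2).
  by move: (@bs i j i (j + 1) i (j + 2) (i + 1) j); rewrite /det2 s00 s10 s01; lia.
have RTT : s (i + 1) (j + 2).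
  by move: (@bs (i - 1) j i (j + 1) (i + 1) (j + 2) i j);
    rewrite /det2 s00 s01 L; lia.
have RT : s (i + 1) (j + 1).
  by move: (@bs (i + 1) j (i + 1) (j + 1) (i + 1) (j + 2) i (j + 1));
    rewrite /det2 s10 s01 RTT; lia.
have LT : s (i - 1) (j + 1).
  by move: (@bs (i - 1) (j + 1) i (j + 1) (i + 1) (j + 1) i j);
    rewrite /det2 s00 s01 RT; lia.
have RB : s (i + 1) (j - 1).
  by move: (@bs (i + 1) (j - 1) (i + 1) j (i + 1) (j + 1) i j);
    rewrite /det2 s00 s10 RT; lia.
by rewrite /corner !subrK -!addrA L B RR TT RT LT RB s00 s10 s01.
Qed.

Lemma border_closed_corner_full :
  s 0 0 -> s 1 0 -> s 0 1 -> forall i j, s i j.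
Proof.
move=> s00 s10 s01 i j.
suff /and3P[] : corner i j by [].
elim/int_step_ind: j => [|j /corner_spread[]//|j /corner_spread[]//].
elim/int_step_ind: i => [|i /corner_spread[]//|i /corner_spread[]//].
by rewrite /corner s00 s10 s01.
Qed.

End BorderClosed.

Lemma border_closed_unimodular s (a1 a2 b1 b2 c1 c2 : int) :
  border_closed s -> `|det2 (b1 - a1) (b2 - a2) (c1 - a1) (c2 - a2)| = 1 ->
  s a1 a2 -> s b1 b2 -> s c1 c2 -> forall x y, s x y.
Proof.
move=> bs uni sa sb sc x y.
have [[i j] /(_ 0 0)] := reparam_surj s a1 a2 x y uni.
rewrite !mul0r !addr0 /= => <-.
apply: (border_closed_corner_full (border_closed_reparam a1 a2 uni bs));
  by rewrite /reparam !mul0r ?mul1r ?addr0 // addrC subrK addrC subrK.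
Qed.

(* A triangle with determinant 2 has a side divisible by 2, hence is the
   vertex set of a border triangle. *)
Lemma border_closed_area2 s (a1 a2 b1 b2 c1 c2 : int) :
  border_closed s -> `|det2 (b1 - a1) (b2 - a2) (c1 - a1) (c2 - a2)| = 2 ->
  s a1 a2 -> s b1 b2 -> s c1 c2 -> forall x y, s x y.
Proof.
move=> bs; rewrite /det2.
(* The case of a side [pq] with lattice midpoint [m]: the midpoint is forced into [s], and half of
   the triangle is unimodular. *)
have aux p1 p2 q1 q2 r1 r2 m1 m2 : `|det2 (q1 - p1) (q2 - p2) (r1 - p1) (r2 - p2)| = 2 ->
    p1 + q1 = 2 * m1 -> p2 + q2 = 2 * m2 ->
    s p1 p2 -> s q1 q2 -> s r1 r2 -> forall x y, s x y.
  move=> D e1 e2 sp sq sr.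
  have uni : `|det2 (q1 - m1) (q2 - m2) (r1 - m1) (r2 - m2)| = 1.
    have q1E : q1 = 2 * m1 - p1 by lia.
    have q2E : q2 = 2 * m2 - p2 by lia.
    have : det2 (q1 - p1) (q2 - p2) (r1 - p1) (r2 - p2) =
           2 * det2 (q1 - m1) (q2 - m2) (r1 - m1) (r2 - m2).
      by rewrite q1E q2E /det2; ring.
    lia.
  have sm : s m1 m2.
    by move: (@bs p1 p2 m1 m2 q1 q2 r1 r2 e1 e2 uni); rewrite sp sq sr; case: (s m1 m2).
  exact: (border_closed_unimodular bs uni).
move=> D sa sb sc.
pose h x : int := (x %/ 2)%Z.
have [/andP[e1 e2]|nab] := boolP ((2 %| a1 + b1)%Z && (2 %| a2 + b2)%Z).
  by apply: (aux a1 a2 b1 b2 c1 c2 (h (a1 + b1)) (h (a2 + b2))) => //; rewrite /h; lia.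
have [/andP[e1 e2]|nac] := boolP ((2 %| a1 + c1)%Z && (2 %| a2 + c2)%Z).
  apply: (aux a1 a2 c1 c2 b1 b2 (h (a1 + c1)) (h (a2 + c2))) => //;
  by rewrite /h /det2; lia.
have [/andP[e1 e2]|nbc] := boolP ((2 %| b1 + c1)%Z && (2 %| b2 + c2)%Z).
  apply: (aux b1 b2 c1 c2 a1 a2 (h (b1 + c1)) (h (b2 + c2))) => //;
  by rewrite /h /det2; lia.
(* Otherwise the vertices are pairwise distinct mod 2, which makes the determinant odd. Splitting
   off the parity bit of each coordinate leaves 64 cases. *)
exfalso.
have : (2 %| (b1 - a1) * (c2 - a2) - (b2 - a2) * (c1 - a1))%Z by lia.
move: nab nac nbc.
have hh (x : int) : exists k (e : bool), x = 2 * k + e%:Z.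
  exists (x %/ 2)%Z, (x %% 2 == 1)%Z; lia.
have [k1 [e1 ->]] := hh a1. have [k2 [e2 ->]] := hh a2.
have [l1 [f1 ->]] := hh b1. have [l2 [f2 ->]] := hh b2.
have [m1 [g1 ->]] := hh c1. have [m2 [g2 ->]] := hh c2.
rewrite (_ : (_ - _) * _ - _ = 2 * (
  (2 * l1 + f1 - (2 * k1 + e1)) * (m2 - k2) + (l1 - k1) * (g2%:Z - e2%:Z)
   - (2 * l2 + f2 - (2 * k2 + e2)) * (m1 - k1) - (l2 - k2) * (g1%:Z - e1%:Z))
   + ((f1%:Z - e1%:Z) * (g2%:Z - e2%:Z) - (f2%:Z - e2%:Z) * (g1%:Z - e1%:Z))); last ring.
by move: (X in 2 * X + _) => X; clear;
  case: e1; case: e2; case: f1; case: f2; case: g1; case: g2 => /=; lia.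
Qed.

(** The three points and the neighbour [(x + w1, y + w2)] form a border triangle. So that neighbour
    lies in [s], and a unimodular triangle appears. *)
Lemma border_closed_consecutive s (x y v1 v2 w1 w2 : int) :
  border_closed s -> `|det2 v1 v2 w1 w2| = 1 ->
  s (x - v1) (y - v2) -> s x y -> s (x + v1) (y + v2) -> forall p q, s p q.
Proof.
move=> bs uni s1 s2 s3.
have uni' : `|det2 (x + v1 - x) (y + v2 - y) (x + w1 - x) (y + w2 - y)| = 1.
  by rewrite -uni; congr `|det2 _ _ _ _|; ring.
have s4 : s (x + w1) (y + w2).
  move: (@bs (x - v1) (y - v2) x y (x + v1) (y + v2) (x + w1) (y + w2)).
  by rewrite s1 s2 s3 => /(_ _ _ uni'); case: (s _ _) => // H; apply: H; ring.
exact: (border_closed_unimodular bs uni').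
Qed.

(** * Discharging for border triangles *)

(** Runs through the subsets of [cs], with [acc] the points chosen so far; choosing [c] is pruned
    when [ok c acc] fails. Nested [if] keeps call-by-value evaluation from entering pruned
    branches. *)
Fixpoint search (ok : point -> seq point -> bool) (P : seq point -> bool)
    (cs acc : seq point) : bool :=
  if cs is c :: cs' then
    if search ok P cs' acc then
      if ok c acc then search ok P cs' (c :: acc) else true
    else false
  else P acc.

(** The points of [cs] satisfying [t] trace one path of the search, and [ok] never prunes it. *)
Lemma searchP (t : pred point) (ok : point -> seq point -> bool) P cs acc :
  (forall c l, t c -> all t l -> ok c l) -> all t acc ->
  search ok P cs acc -> P (catrev [seq c <- cs | t c] acc).
Proof.
move=> okP; elim: cs acc => //= c cs IH acc tacc.
case: ifP => // h1 h2; case: ifP => tc; last exact: IH.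
by apply: IH; [rewrite /= tc|rewrite okP in h2].
Qed.

Definition translate_count (f : int -> int -> bool) (L : seq point) (x y : int) : nat :=
  sumn [seq nat_of_bool (f (x + k.1) (y + k.2)) | k <- L].

Definition pair_at (s : int -> int -> bool) (d : point) (x y : int) : bool :=
  s x y && s (x + d.1) (y + d.2).

Definition square : seq point := [:: (0, 0); (1, 0); (0, 1); (1, 1)].

(* The charge balance of the unit square at (x, y), multiplied by 6.  On the left
   stand the pairs sending charge to that square, on the right the pairs in it. *)
Definition discharge (s : int -> int -> bool) (x y : int) : bool :=
  (6 * translate_count s square x y
   + 2 * translate_count (pair_at s (1, 0)%R)
       [:: (-1, -1); (0, -1); (1, -1); (-1, 2); (0, 2); (1, 2)]%R x y
   + 2 * translate_count (pair_at s (0, 1)%R)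
       [:: (-1, -1); (-1, 0); (-1, 1); (2, -1); (2, 0); (2, 1)]%R x y
   + 3 * translate_count (pair_at s (1, 1)%R) [:: (-2, -1); (-1, -2)]%R x y
   + 3 * translate_count (pair_at s (1, -1)%R) [:: (2, 0); (1, -1)]%R x y
   <= 6
   + 6 * translate_count (pair_at s (1, 0)%R) [:: (0, 0); (0, 1)]%R x y
   + 6 * translate_count (pair_at s (0, 1)%R) [:: (0, 0); (1, 0)]%R x y
   + 6 * translate_count (pair_at s (1, 1)%R) [:: (0, 0)]%R x y
   + 6 * translate_count (pair_at s (1, -1)%R) [:: (0, 1)]%R x y)%N.

(** All points that [discharge] reads at the origin: the 4 by 4 block around the unit square and the
    four far ends of the diagonal pairs. *)
Definition discharge_cells : seq point :=
  [seq (i, j) | i <- [:: -1; 0; 1; 2], j <- [:: -1; 0; 1; 2]]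
  ++ [:: (-2, -1); (-1, -2); (3, -1); (2, -2)].

Definition tdet (a b c : point) : int :=
  det2 (b.1 - a.1) (b.2 - a.2) (c.1 - a.1) (c.2 - a.2).

Definition consecutive (a b c : point) : bool :=
  [&& a.1 + c.1 == 2 * b.1, a.2 + c.2 == 2 * b.2 &
      (b.1 - a.1, b.2 - a.2) \in
        [:: (1, 0); (0, 1); (1, 1); (1, -1); (-1, 0); (0, -1); (-1, -1); (-1, 1)]].

(** Triples that force a border closed set to be the whole plane. *)
Definition thin_triple (a b c : point) : bool :=
  if tdet a b c \in [:: 1; 2; -1; -2] then true else
  [|| consecutive a b c, consecutive a c b | consecutive b a c].

Definition thin_free (c : point) (l : seq point) : bool :=
  all (fun a => all (fun b => ~~ thin_triple a b c) l) l.

Lemma discharge_search :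
  search thin_free (fun l => discharge (fun i j => (i, j) \in l) 0 0)
    discharge_cells [::].
Proof. by vm_compute. Qed.

Lemma consecutive_full s (a b c : point) : border_closed s ->
  consecutive a b c -> s a.1 a.2 -> s b.1 b.2 -> s c.1 c.2 -> forall x y, s x y.
Proof.
case: a b c => [a1 a2] [b1 b2] [c1 c2] bs /and3P[/= /eqP e1 /eqP e2 d] sa sb sc.
set v1 := b1 - a1 in d; set v2 := b2 - a2 in d.
have [w uni] : exists w : point, `|det2 v1 v2 w.1 w.2| = 1.
  move: v1 v2 d => v1 v2; rewrite !inE => d.
  exists (if v1 == 0 then (1, 0) else (0, 1)).
  by move: d; do 7?[case/orP]; move=> /eqP[-> ->].
apply: (border_closed_consecutive (x := b1) (y := b2) bs uni) => //.
- by rewrite !subKr.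
- have -> : b1 + v1 = c1 by rewrite /v1; lia.
  by have -> : b2 + v2 = c2 by rewrite /v2; lia.
Qed.

Lemma thin_triple_full s (a b c : point) : border_closed s ->
  thin_triple a b c -> s a.1 a.2 -> s b.1 b.2 -> s c.1 c.2 -> forall x y, s x y.
Proof.
move=> bs; rewrite /thin_triple; case: ifP => [D _ sa sb sc|_].
  have [D1|D2] : `|tdet a b c| = 1 \/ `|tdet a b c| = 2.
    by move: D; rewrite !inE; lia.
  - exact: (border_closed_unimodular bs D1).
  - exact: (border_closed_area2 bs D2).
by case/or3P => /(consecutive_full bs) H sa sb sc; apply: H.
Qed.

Lemma translate_count_shift s L x y :
  translate_count s L x y = translate_count (fun i j => s (x + i) (y + j)) L 0 0.
Proof.
by rewrite /translate_count; congr sumn; apply: eq_map => k; rewrite !add0r.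
Qed.

(** After translation to the origin, the trace of [s] on the 20 cells contains no thin triple, so it
    is one of the configurations checked by [discharge_search]. *)
Lemma discharge_border_closed s x y :
  border_closed s -> ~ (forall p q, s p q) -> discharge s x y.
Proof.
move=> bs nfull.
pose t (z : point) := s (x + z.1) (y + z.2).
have okP c l : t c -> all t l -> thin_free c l.
  move=> tc /allP tl; apply/allP => a /tl ta; apply/allP => b /tl tb.
  apply/negP => thin; apply: nfull => p q.
  have uni : `|det2 1 0 0 1| = 1 by [].
  have bs' := border_closed_reparam x y uni bs.
  have e (z : point) : t z = reparam s x y 1 0 0 1 z.1 z.2.
    by rewrite /t /reparam; congr s; ring.
  rewrite e in ta; rewrite e in tb; rewrite e in tc.
  have := thin_triple_full bs' thin ta tb tc (p - x) (q - y).
  by rewrite /reparam; congr is_true; congr s; ring.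
have := searchP (acc := [::]) okP isT discharge_search.
set l := catrev _ _.
have E i j : (i, j) \in discharge_cells -> ((i, j) \in l) = s (x + i) (y + j).
  by move=> ij; rewrite mem_rev mem_filter ij andbT.
rewrite /discharge !(translate_count_shift _ _ x y).
rewrite /translate_count /pair_at /= !E //.
by rewrite -!addrA /= !addr0.
Qed.

(** * Periodicity for internal triangles *)

Section InternalClosedCorner.
Variable s : int -> int -> bool.
Hypothesis is_ : internal_closed s.
Hypotheses (s00 : s 0 0) (s10 : s 1 0) (s01 : s 0 1).

Let fill (o1 o2 a1 a2 b1 b2 c1 c2 : int) :
    a1 + b1 + c1 = 3 * o1 -> a2 + b2 + c2 = 3 * o2 ->
    `|det2 (a1 - o1) (a2 - o2) (b1 - o1) (b2 - o2)| = 1 ->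
  s o1 o2 -> s a1 a2 -> s b1 b2 -> s c1 c2.
Proof.
move=> e1 e2 e3 so sa sb; have := is_ e1 e2 e3.
by rewrite so sa sb; case: (s c1 c2).
Qed.

(** A chain of fillings leads from the corner at the origin to the corner at [(4, 0)]. Applied in
    other bases, it is the source of the period 4. *)
Lemma internal_closed_shift :
  [/\ s (-1) (-1), s 4 0, s 5 0 & s 4 1].
Proof.
have c : s (-1) (-1) by apply: (@fill 0 0 1 0 0 1).
have ca : s 3 (-1) by apply: (@fill 1 0 0 0 0 1).
have ba : s 4 1 by apply: (@fill 1 0 0 0 (-1) (-1)).
have bc : s (-4) (-3) by apply: (@fill (-1) (-1) 0 0 1 0).
have ac : s 5 4 by apply: (@fill 0 0 (-1) (-1) (-4) (-3)).
have o : s 4 0 by apply: (@fill 4 1 3 (-1) 5 4).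
by split=> //; apply: (@fill 4 0 4 1 3 (-1)).
Qed.

End InternalClosedCorner.

Lemma internal_closed_shift_gen s (x y v1 v2 w1 w2 : int) :
  internal_closed s -> `|det2 v1 v2 w1 w2| = 1 ->
  s x y -> s (x + v1) (y + v2) -> s (x + w1) (y + w2) ->
  [/\ s (x - v1 - w1) (y - v2 - w2), s (x + 4 * v1) (y + 4 * v2),
      s (x + 4 * v1 + v1) (y + 4 * v2 + v2) &
      s (x + 4 * v1 + w1) (y + 4 * v2 + w2)].
Proof.
move=> is_ uni so sv sw.
have := internal_closed_shift (internal_closed_reparam x y uni is_).
rewrite /reparam !mul0r !mul1r !addr0 => /(_ so sv sw).
case=> h1 h2 h3 h4; split; [move: h1|move: h2|move: h3|move: h4];
  by congr is_true; congr s; ring.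
Qed.

(** The translations by [(4, 0)], [(0, 4)] and [(-4, -4)] each preserve corners, and together they
    reach all of 4Z^2 without inverses. *)
Lemma internal_closed_lattice s (x y v1 v2 w1 w2 i j : int) :
  internal_closed s -> `|det2 v1 v2 w1 w2| = 1 ->
  s x y -> s (x + v1) (y + v2) -> s (x + w1) (y + w2) ->
  [/\ s (x + 4 * (i * v1 + j * w1)) (y + 4 * (i * v2 + j * w2)),
      s (x + 4 * (i * v1 + j * w1) + v1) (y + 4 * (i * v2 + j * w2) + v2) &
      s (x + 4 * (i * v1 + j * w1) + w1) (y + 4 * (i * v2 + j * w2) + w2)].
Proof.
move=> is_ uni so sv sw.
pose t := reparam s x y v1 v2 w1 w2.
pose corner p q := [&& t p q, t (p + 1) q & t p (q + 1)].
have it : internal_closed t by apply: internal_closed_reparam.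
have step p q : corner p q -> [/\ corner (p + 4) q, corner p (q + 4) & corner (p - 4) (q - 4)].
  case/and3P => t00 t10 t01.
  have t10' : t (p + 1) (q + 0) by rewrite addr0.
  have t01' : t (p + 0) (q + 1) by rewrite addr0.
  have [tc a1 a2 a3] := internal_closed_shift_gen it (erefl : `|det2 1 0 0 1| = 1) t00 t10' t01'.
  have [_ b1 b2 b3] := internal_closed_shift_gen it (erefl : `|det2 0 1 1 0| = 1) t00 t01' t10'.
  have tc' : t (p + -1) (q + -1) by move: tc; rewrite !subr0.
  (* The triangle on [(p, q)], [(p - 1, q - 1)], [(p + 1, q)] moves by [(-4, -4)]. The missing point
     above its new origin is then minus the sum of the two basis vectors, recovered as [c4]. *)
  have [_ c1 c2 c3] := internal_closed_shift_gen it (erefl : `|det2 (-1) (-1) 1 0| = 1) t00 tc' t10'.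
  have [c4 _ _ _] := internal_closed_shift_gen it (erefl : `|det2 (-1) (-1) 1 0| = 1) c1 c2 c3.
  split; apply/and3P; split.
  - by move: a1; congr is_true; congr t; ring.
  - by move: a2; congr is_true; congr t; ring.
  - by move: a3; congr is_true; congr t; ring.
  - by move: b1; congr is_true; congr t; ring.
  - by move: b3; congr is_true; congr t; ring.
  - by move: b2; congr is_true; congr t; ring.
  - by move: c1; congr is_true; congr t; ring.
  - by move: c3; congr is_true; congr t; ring.
  - by move: c4; congr is_true; congr t; ring.
have all p q : corner (4 * p) (4 * q).
  elim/int_step_ind: q => [|q|q].
  - elim/int_step_ind: p => [|p|p].
    + apply/and3P; rewrite /t /reparam !mulr0 !add0r !mul0r !mul1r !addr0.
      by split.
    + by case/step => + _ _; rewrite mulrDr mulr1.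
    + case/step => _ _ /step[_ + _]; congr is_true; congr corner; ring.
  - by case/step => _ + _; rewrite [4 * (q + 1)]mulrDr mulr1.
  - case/step => _ _ /step[+ _ _]; congr is_true; congr corner; ring.
have /and3P[h1 h2 h3] := all i j; split.
- by move: h1; rewrite /t /reparam; congr is_true; congr s; ring.
- by move: h2; rewrite /t /reparam; congr is_true; congr s; ring.
- by move: h3; rewrite /t /reparam; congr is_true; congr s; ring.
Qed.

Lemma internal_closed_vertex_period s (a1 a2 b1 b2 c1 c2 i j : int) :
  internal_closed s -> `|det2 (b1 - a1) (b2 - a2) (c1 - a1) (c2 - a2)| = 1 ->
  s a1 a2 -> s b1 b2 -> s c1 c2 -> s (a1 + 4 * i) (a2 + 4 * j).
Proof.
set v1 := b1 - a1; set v2 := b2 - a2; set w1 := c1 - a1; set w2 := c2 - a2.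
move=> is_ uni sa sb sc; set D := det2 v1 v2 w1 w2 in uni.
have DD : D * D = 1 by have [->|->] : D = 1 \/ D = -1 by lia.
have sb' : s (a1 + v1) (a2 + v2) by rewrite ![_ + (_ - _)]addrC !subrK.
have sc' : s (a1 + w1) (a2 + w2) by rewrite ![_ + (_ - _)]addrC !subrK.
have [h _ _] := internal_closed_lattice
  (D * det2 i j w1 w2) (D * det2 v1 v2 i j) is_ uni sa sb' sc'.
move: h; congr is_true; congr s; congr (_ + 4 * _).
- by transitivity (D * D * i); [rewrite /D /det2; ring|rewrite DD mul1r].
- by transitivity (D * D * j); [rewrite /D /det2; ring|rewrite DD mul1r].
Qed.

(** Every point of [s] forms a unimodular triangle with two points of the corners repeated along
    4Z^2, and so inherits the period as a vertex of that triangle. *)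
Lemma internal_closed_corner_period s : internal_closed s ->
  s 0 0 -> s 1 0 -> s 0 1 -> forall x y i j, s x y -> s (x + 4 * i) (y + 4 * j).
Proof.
move=> is_ s00 s10 s01 x y i j sxy.
have L p q : [/\ s (4 * p) (4 * q), s (4 * p + 1) (4 * q) & s (4 * p) (4 * q + 1)].
  have [] := @internal_closed_lattice s 0 0 1 0 0 1 p q is_ erefl s00 s10 s01.
  by rewrite !mulr0 !mulr1 !addr0 !add0r.
have [yo|ye] := boolP (2 %| y)%Z; last first.
  (* For odd [y], [4 * q] is the multiple of 4 adjacent to [y], so a horizontal edge at that height
     gives determinant 1 or -1. *)
  pose q := ((y + 1) %/ 4)%Z.
  have [h1 h2 _] := L 0 q.
  apply: (internal_closed_vertex_period i j is_ _ sxy h1 h2).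
  have -> : det2 (4 * 0 - x) (4 * q - y) (4 * 0 + 1 - x) (4 * q - y) = y - 4 * q.
    by rewrite /det2; ring.
  by move: ye; rewrite /q; lia.
have [xo|xe] := boolP (2 %| x)%Z; last first.
  pose p := ((x + 1) %/ 4)%Z.
  have [h1 _ h2] := L p 0.
  apply: (internal_closed_vertex_period i j is_ _ sxy h1 h2).
  have -> : det2 (4 * p - x) (4 * 0 - y) (4 * p - x) (4 * 0 + 1 - y) = 4 * p - x.
    by rewrite /det2; ring.
  by move: xe; rewrite /p; lia.
(* Both coordinates are even, so the edge from [(4 * m + 1, 0)] to [(4 * m, 1)] serves: [x + y] is 0
   or 2 mod 4, and the determinant is 1 or -1. *)
pose m := ((x + y) %/ 4)%Z.
have [_ h1 _] := L m 0; have [_ _ h2] := L m 0.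
apply: (internal_closed_vertex_period i j is_ _ sxy h1 h2).
have -> : det2 (4 * m + 1 - x) (4 * 0 - y) (4 * m - x) (4 * 0 + 1 - y) =
   1 + 4 * m - x - y by rewrite /det2; ring.
by rewrite /m; lia.
Qed.

Lemma internal_closed_period s (a1 a2 b1 b2 c1 c2 : int) :
  internal_closed s -> `|det2 (b1 - a1) (b2 - a2) (c1 - a1) (c2 - a2)| = 1 ->
  s a1 a2 -> s b1 b2 -> s c1 c2 ->
  forall x y i j, s x y -> s (x + 4 * i) (y + 4 * j).
Proof.
set v1 := b1 - a1; set v2 := b2 - a2; set w1 := c1 - a1; set w2 := c2 - a2.
move=> is_ uni sa sb sc x y i j.
have [[p q] e] := reparam_surj s a1 a2 x y uni.
set D := det2 v1 v2 w1 w2 in uni.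
have DD : D * D = 1 by have [->|->] : D = 1 \/ D = -1 by lia.
have e0 := e 0 0; rewrite !mul0r !addr0 in e0; rewrite -e0 => sxy.
have := internal_closed_corner_period (internal_closed_reparam a1 a2 uni is_)
  _ _ _ (D * det2 i j w1 w2) (D * det2 v1 v2 i j) sxy.
rewrite e /reparam !mul0r !mul1r !addr0.
rewrite ![_ + (_ - _)]addrC !subrK => /(_ sa sb sc).
congr is_true; congr s; congr (_ + _).
- by transitivity (4 * (D * D * i)); [rewrite /D /det2; ring|rewrite DD mul1r].
- by transitivity (4 * (D * D * j)); [rewrite /D /det2; ring|rewrite DD mul1r].
Qed.

(** * Exhaustive search over the subsets of (Z/4)^2 *)

Fixpoint forall_bits (P : seq bool -> bool) (n : nat) (acc : seq bool) : bool :=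
  if n is n'.+1 then
    if forall_bits P n' (false :: acc) then forall_bits P n' (true :: acc) else false
  else P acc.

Lemma forall_bitsP P n acc (f : nat -> bool) :
  forall_bits P n acc -> P (mkseq f n ++ acc).
Proof.
elim: n acc => [//|n IH acc]; rewrite mkseqS cat_rcons [forall_bits _ _ _]/=.
by case: ifP => // h1 h2; case: (f n); apply: IH.
Qed.

Definition grid4 : seq point :=
  [seq (i, j) | i <- [:: 0; 1; 2; 3], j <- [:: 0; 1; 2; 3]].

Definition mod4_index (z : point) : nat := (`|(z.1 %% 4)%Z| * 4 + `|(z.2 %% 4)%Z|)%N.

Definition internal_points (p v w : point) : seq point :=
  [:: p; (p.1 + v.1, p.2 + v.2); (p.1 + w.1, p.2 + w.2);
      (p.1 - v.1 - w.1, p.2 - v.2 - w.2)].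

(** For each of the 16 centres, the four internal triangles with [v] horizontal and [w] vertical of
    length 1, reduced mod 4. *)
Definition internal_mod4 : seq (seq nat) :=
  [seq [seq mod4_index z | z <- internal_points p.1 p.2 (0, w)] |
     p <- [seq (p, (v, 0)) | p <- grid4, v <- [:: 1; -1]], w <- [:: 1; -1]].

Definition mod4_ok (ts : seq (seq nat)) (b : seq bool) : bool :=
  if (count id b <= 8)%N then true else if all id b then true else
  has (fun t => count (nth false b) t == 3%N) ts.

Lemma mod4_search : let ts := internal_mod4 in forall_bits (mod4_ok ts) 16 [::].
Proof. by vm_compute. Qed.

(** By periodicity 16 bits describe [s]. More than 8 set bits leave two outcomes of the search: all
    bits set, which makes [s] full, or a triangle with exactly three points, which violates
    closure. *)
Lemma internal_mod4_closed s : internal_closed s ->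
  (forall x y i j, s x y -> s (x + 4 * i) (y + 4 * j)) ->
  ~ (forall x y, s x y) ->
  forall x y, (translate_count s grid4 x y <= 8)%N.
Proof.
move=> is_ per nfull x y.
pose t i j := s (x + i) (y + j).
pose f k := t (k %/ 4)%N%:Z (k %% 4)%N%:Z.
have tE i j : t i j = nth false (mkseq f 16) (mod4_index (i, j)).
  have bd (k : int) : (`|(k %% 4)%Z| < 4)%N by lia.
  have bi := bd i; have bj := bd j.
  rewrite nth_mkseq; last by rewrite /mod4_index /=; lia.
  rewrite /f /mod4_index /= divnMDl // divn_small // addn0 modnMDl modn_small //.
  have e (k : int) : `|(k %% 4)%Z|%N%:Z = (k %% 4)%Z by lia.
  rewrite !e /t; apply/idP/idP => [/per|/per] h.
  - move: (h (- (i %/ 4)%Z) (- (j %/ 4)%Z)); congr is_true; congr s; lia.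
  - move: (h (i %/ 4)%Z (j %/ 4)%Z); congr is_true; congr s; lia.
have := forall_bitsP f mod4_search; rewrite cats0 /mod4_ok.
have -> : translate_count s grid4 x y = count id (mkseq f 16).
  by rewrite translate_count_shift -/t /translate_count /= /f /= !add0r.
case: ifP => // _.
case: ifP => [/allP al _|_].
  exfalso; apply: nfull => p q.
  have := tE (p - x) (q - y); rewrite /t ![_ + (_ - _)]addrC !subrK => ->.
  apply: al; apply: mem_nth; rewrite size_mkseq /mod4_index /=; lia.
case/hasP => _ /allpairsP[[[p v] w] [/allpairsP[[p' v'] [_ v1 [-> ->]]] w1 ->]].
move: v1 w1; rewrite [_.2]/= [_.2]/= => v1 w1 /=.
rewrite !addr0 => /eqP c3; exfalso.
have := is_ (x + p'.1) (y + p'.2) (x + (p'.1 + v')) (y + p'.2)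
  (x + p'.1) (y + (p'.2 + w)) (x + (p'.1 - v')) (y + (p'.2 - w)).
rewrite -!/(t _ _) !tE => /(_ _ _ _)/eqP; apply.
- ring.
- ring.
- by move: v1 w1; rewrite /det2 !inE => /orP[]/eqP-> /orP[]/eqP->; lia.
- by move: c3; case: (p') => p1 p2; rewrite !addnA addn0.
Qed.

(* A unit square with three points of [s] contains a unimodular triangle, and
   then [s] is periodic; otherwise unit squares have at most two points. *)
Lemma internal_closed_count s : internal_closed s -> ~ (forall x y, s x y) ->
  (forall x y, translate_count s square x y <= 2)%N \/
  (forall x y, translate_count s grid4 x y <= 8)%N.
Proof.
move=> is_ nfull.
have [?|/existsNP[x /existsNP[y /negP]]] := pselect (forall x y, translate_count s square x y <= 2)%N.
  by left.
rewrite -ltnNge /translate_count /= !addr0 !addn0 => c3; right.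
have [[[a1 a2] [b1 b2]] [[c1 c2] [uni sa sb sc]]] : exists ab : point * point,
   exists c : point, [/\ `|det2 (ab.2.1 - ab.1.1) (ab.2.2 - ab.1.2) (c.1 - ab.1.1) (c.2 - ab.1.2)| = 1,
   s ab.1.1 ab.1.2, s ab.2.1 ab.2.2 & s c.1 c.2].
  have [s00|n00] := boolP (s x y); last first.
    exists ((x + 1, y + 1), (x + 1, y)), (x, y + 1) => /=; rewrite /det2; split; lia.
  have [s10|n10] := boolP (s (x + 1) y); last first.
    exists ((x, y), (x + 1, y + 1)), (x, y + 1) => /=; rewrite /det2; split; lia.
  have [s01|n01] := boolP (s x (y + 1)); last first.
    exists ((x, y), (x + 1, y)), (x + 1, y + 1) => /=; rewrite /det2; split; lia.
  exists ((x, y), (x + 1, y)), (x, y + 1) => /=; rewrite /det2; split => //; lia.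
exact: internal_mod4_closed (internal_closed_period is_ uni sa sb sc) nfull.
Qed.

(** * Sums over boxes *)

Definition box_sum (f : int -> int -> nat) (n : nat) : nat :=
  (\sum_(i < n.*2.+1) \sum_(j < n.*2.+1) f (i%:Z - n%:Z)%R (j%:Z - n%:Z)%R)%N.

Lemma leq_box_sum f g n : (forall x y, f x y <= g x y)%N ->
  (box_sum f n <= box_sum g n)%N.
Proof. by move=> fg; apply: leq_sum => i _; apply: leq_sum => j _. Qed.

Lemma box_sumD f g n :
  box_sum (fun x y => f x y + g x y)%N n = (box_sum f n + box_sum g n)%N.
Proof. by rewrite /box_sum -big_split; apply: eq_bigr => i _; rewrite -big_split. Qed.

Lemma box_sum_cst k n : box_sum (fun _ _ => k) n = (k * (n.*2.+1 * n.*2.+1))%N.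
Proof. by rewrite /box_sum !sum_nat_const !card_ord mulnCA (mulnC k) mulnA. Qed.

(** Windows one step apart differ by one term at each end, and a term is at most [B]. *)
Lemma leq_sum_int_shift1 (g : int -> nat) (B M : nat) (c : int) :
  (forall x, g x <= B)%N ->
  (\sum_(i < M) g (i%:Z + (c + 1))%R <= \sum_(i < M) g (i%:Z + c)%R + B)%N /\
  (\sum_(i < M) g (i%:Z + (c - 1))%R <= \sum_(i < M) g (i%:Z + c)%R + B)%N.
Proof.
move=> gB; have shift d : (\sum_(i < M.+1) g (i%:Z + d)%R =
    g d + \sum_(i < M) g (i%:Z + (d + 1))%R)%N.
  rewrite big_ord_recl add0r; congr addn; apply: eq_bigr => i _.
  by rewrite lift0 -addn1 PoszD -addrA (addrC 1).
split.
- have := shift c; rewrite big_ord_recr /=.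
  by have := gB (M%:Z + c); lia.
- have := shift (c - 1); rewrite big_ord_recr /= subrK.
  by have := gB (c - 1); lia.
Qed.

Lemma leq_sum_int_shift (g : int -> nat) (B M : nat) (c a : int) :
  (forall x, g x <= B)%N ->
  (\sum_(i < M) g (i%:Z + (c + a))%R <= \sum_(i < M) g (i%:Z + c)%R + `|a| * B)%N.
Proof.
move=> gB; elim/int_ind: a => [|n IH|n IH]; first by rewrite addr0 addn0.
- rewrite -addn1 PoszD addrA absz_nat mulnDl mul1n addnA.
  apply: leq_trans (leq_sum_int_shift1 M (c + n%:Z) gB).1 _.
  by rewrite leq_add2r.
- rewrite -addn1 PoszD opprD addrA -opprD abszN absz_nat mulnDl mul1n addnA.
  apply: leq_trans (leq_sum_int_shift1 M (c - n%:Z) gB).2 _.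
  by rewrite leq_add2r; move: IH; rewrite abszN.
Qed.

(** One coordinate is shifted at a time: a unit step in [y] costs at most 1 in each of the [M]
    columns, and a unit step in [x] costs one whole column, at most [M]. *)
Lemma leq_box_sum_shift (f : int -> int -> bool) (a b : int) n :
  (box_sum (fun x y => f (x + a)%R (y + b)%R) n <=
   box_sum f n + (`|a| + `|b|) * n.*2.+1)%N.
Proof.
rewrite /box_sum; set M := n.*2.+1.
apply: (@leq_trans (\sum_(i < M) \sum_(j < M) f (i%:Z + (- n%:Z + a))%R (j%:Z - n%:Z)%R
    + `|b| * M)%N).
  rewrite -[X in (_ + _ * X)%N]card_ord mulnC -sum_nat_const -big_split /=.
  apply: leq_sum => i _; rewrite addrA.
  have f1 y : (f (i%:Z - n%:Z + a)%R y <= 1)%N by case: (f _ _).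
  have := leq_sum_int_shift M (- n%:Z) b f1; rewrite muln1; apply: leq_trans.
  by apply: leq_sum => j _; rewrite addrA.
rewrite mulnDl addnA leq_add2r.
apply: (@leq_sum_int_shift (fun x => \sum_(j < M) f x (j%:Z - n%:Z)%R)%N M M).
move=> x; rewrite -[X in (_ <= X)%N]card_ord -sum1_card; apply: leq_sum => j _.
by case: (f _ _).
Qed.

Definition shift_cost (L : seq point) : nat :=
  sumn [seq (`|k.1| + `|k.2|)%N | k <- L].

Lemma leq_box_sum_translate (f : int -> int -> bool) L n :
  (box_sum (translate_count f L) n <=
   size L * box_sum f n + shift_cost L * n.*2.+1)%N.
Proof.
elim: L => [|k L IH].
  by rewrite /box_sum /translate_count /= big1 // => i _; rewrite big1.
rewrite (_ : translate_count f (k :: L) = fun x y =>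
  (f (x + k.1)%R (y + k.2)%R + translate_count f L x y)%N) //.
rewrite box_sumD /= /shift_cost /= -/(shift_cost L) mulSn mulnDl addnACA.
by rewrite leq_add // leq_box_sum_shift.
Qed.

Lemma geq_box_sum_translate (f : int -> int -> bool) L n :
  (size L * box_sum f n <=
   box_sum (translate_count f L) n + shift_cost L * n.*2.+1)%N.
Proof.
elim: L => [//|k L IH].
rewrite (_ : translate_count f (k :: L) = fun x y =>
  (f (x + k.1)%R (y + k.2)%R + translate_count f L x y)%N) //.
rewrite box_sumD /= /shift_cost /= -/(shift_cost L) mulSn mulnDl addnACA.
rewrite leq_add //.
(* Shifting the translate back by [-k] restores [f], which turns the upper bound into a lower
   one. *)
have := leq_box_sum_shift (fun x y => f (x + k.1) (y + k.2)) (- k.1) (- k.2) n.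
rewrite !abszN; apply: leq_trans; apply: leq_box_sum => x y.
by rewrite !subrK.
Qed.

Lemma leq_box_sum_discharge (t h v d e h' v' d' e' : int -> int -> nat) n :
  (forall x y, 6 * t x y + 2 * h x y + 2 * v x y + 3 * d x y + 3 * e x y <=
     6 + 6 * h' x y + 6 * v' x y + 6 * d' x y + 6 * e' x y)%N ->
  (6 * box_sum t n + 2 * box_sum h n + 2 * box_sum v n + 3 * box_sum d n
     + 3 * box_sum e n <=
   6 * (n.*2.+1 * n.*2.+1) + 6 * box_sum h' n + 6 * box_sum v' n
     + 6 * box_sum d' n + 6 * box_sum e' n)%N.
Proof.
move=> H; rewrite -box_sum_cst /box_sum !big_distrr -!big_split.
apply: leq_sum => i _; rewrite /= !big_distrr -!big_split.
by apply: leq_sum => j _; exact: H.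
Qed.

(** Up to boundary terms, every kind of pair is sent and received with equal total weight:
    [2 * 6 = 6 * 2] for horizontal and vertical pairs, [3 * 2 = 6 * 1] for diagonal ones. Each point
    lies in four squares, so 24 times the count is at most 6 times the area. *)
Lemma border_closed_box_sum s : border_closed s -> ~ (forall x y, s x y) ->
  exists C, forall n, (4 * box_sum s n <= n.*2.+1 * n.*2.+1 + C * n.*2.+1)%N.
Proof.
(* The weighted shift costs add up to 124, and a sixth of that is asked for; 200 is generous. *)
move=> bs nfull; exists 200%N => n.
have := leq_box_sum_discharge n (fun x y => discharge_border_closed x y bs nfull).
have := geq_box_sum_translate s square n.
pose lo d L := geq_box_sum_translate (pair_at s d) L n.
pose hi d L := leq_box_sum_translate (pair_at s d) L n.
have := lo (1, 0) [:: (-1, -1); (0, -1); (1, -1); (-1, 2); (0, 2); (1, 2)].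
have := lo (0, 1) [:: (-1, -1); (-1, 0); (-1, 1); (2, -1); (2, 0); (2, 1)].
have := lo (1, 1) [:: (-2, -1); (-1, -2)].
have := lo (1, -1) [:: (2, 0); (1, -1)].
have := hi (1, 0) [:: (0, 0); (0, 1)].
have := hi (0, 1) [:: (0, 0); (1, 0)].
have := hi (1, 1) [:: (0, 0)].
have := hi (1, -1) [:: (0, 1)].
rewrite /shift_cost [size _]/=.
move: (n.*2.+1) => M /=.
set MM := (M * M)%N.
lia.
Qed.

(** Averages of 2 out of 4 or of 8 out of 16 both give density one half. The constants are the shift
    costs 4 and 48 divided by 2 and 8. *)
Lemma internal_closed_box_sum s : internal_closed s -> ~ (forall x y, s x y) ->
  exists C, forall n, (2 * box_sum s n <= n.*2.+1 * n.*2.+1 + C * n.*2.+1)%N.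
Proof.
move=> is_ nfull; have [H|H] := internal_closed_count is_ nfull.
- exists 2%N => n; have := leq_box_sum n H.
  have := geq_box_sum_translate s square n; rewrite box_sum_cst /shift_cost /=.
  move: (n.*2.+1) => M; set MM := (M * M)%N; lia.
- exists 6%N => n; have := leq_box_sum n H.
  have := geq_box_sum_translate s grid4 n; rewrite box_sum_cst /shift_cost /=.
  move: (n.*2.+1) => M; set MM := (M * M)%N; lia.
Qed.

(** * Triangles in the real plane *)

Section PlaneGeometry.
Variable R : realType.
Implicit Types (a b c x : R * R) (A : set (R * R)).

Definition rdet a b c : R :=
  (b.1 - a.1) * (c.2 - a.2) - (b.2 - a.2) * (c.1 - a.1).

Lemma convex_setP A : @convex_set R (R * R)%type A <->
  forall x y (t : R), 0 <= t <= 1 -> A x -> A y ->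
    A (t * x.1 + (1 - t) * y.1, t * x.2 + (1 - t) * y.2).
Proof.
split=> [cA x y t /andP[t0 t1] Ax Ay|cA x y t].
  by have := cA x y (Itv01 t0 t1); rewrite !inE; apply.
rewrite !inE => Ax Ay; apply: (cA x y t%:num) => //.
by apply/andP; split; [exact: ge0|exact: le1].
Qed.

Lemma convex_set_barycenter A a b c (p q r : R) : @convex_set R (R * R)%type A ->
  A a -> A b -> A c -> 0 <= p -> 0 <= q -> 0 <= r -> p + q + r = 1 ->
  A (p * a.1 + q * b.1 + r * c.1, p * a.2 + q * b.2 + r * c.2).
Proof.
move=> /convex_setP cA Aa Ab Ac p0 q0 r0 pqr1.
(* The point is reached by two successive segments, the first with ratio [p / (p + q)]; when
   [p + q = 0] it is [c] itself. *)
have [pq0|pq0] := eqVneq (p + q) 0.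
  have [-> ->] : p = 0 /\ q = 0 by lra.
  have -> : r = 1 by lra.
  by rewrite !mul0r !add0r !mul1r; case: (c) Ac.
have pqp : 0 < p + q by rewrite lt_neqAle eq_sym pq0 addr_ge0.
have t01 : 0 <= p / (p + q) <= 1.
  by rewrite divr_ge0 ?addr_ge0 //= ler_pdivrMr // mul1r lerDl.
have s01 : 0 <= p + q <= 1 by lra.
have := cA _ _ _ s01 (cA _ _ _ t01 Aa Ab) Ac => /=.
congr A; congr pair; rewrite (_ : 1 - (p + q) = r); try lra;
  by field; rewrite ?pq0.
Qed.

Lemma sub_convex_hull A : A `<=` convex_hull A.
Proof. exact: sub_gen_smallest. Qed.

Lemma convex_convex_hull A : @convex_set R (R * R)%type (convex_hull A).
Proof.
apply/convex_setP => x y t t01 Ax Ay B [cB AB].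
by move/convex_setP: (cB); apply => //; [apply: Ax|apply: Ay].
Qed.

Lemma convex_halfplane (k l m : R) :
  @convex_set R (R * R)%type [set x | 0 <= k * x.1 + l * x.2 + m].
Proof.
apply/convex_setP => x y t /andP[t0 t1] /= hx hy.
have -> : k * (t * x.1 + (1 - t) * y.1) + l * (t * x.2 + (1 - t) * y.2) + m =
  t * (k * x.1 + l * x.2 + m) + (1 - t) * (k * y.1 + l * y.2 + m) by ring.
by rewrite addr_ge0 // mulr_ge0 // subr_ge0.
Qed.

Lemma convex_hull_halfplane (k l m : R) A :
  (forall x, A x -> 0 <= k * x.1 + l * x.2 + m) ->
  forall x, convex_hull A x -> 0 <= k * x.1 + l * x.2 + m.
Proof.
move=> HA x hx; apply: (hx [set y | 0 <= k * y.1 + l * y.2 + m]).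
by split; [exact: convex_halfplane|exact: HA].
Qed.

Lemma interior_affine_gt0 (k l m : R) x :
  0 < k * x.1 + l * x.2 + m -> \forall y \near x, 0 <= k * y.1 + l * y.2 + m.
Proof.
move=> gx.
have : (fun y : R * R => k * y.1 + l * y.2 + m) @ x --> k * x.1 + l * x.2 + m.
  apply: cvgD; last exact: cvg_cst.
  apply: cvgD; apply: cvgM; try exact: cvg_cst; [exact: cvg_fst|exact: cvg_snd].
by move/cvgr_gt => /(_ 0 gx); apply: filterS => y /ltW.
Qed.

(** From a zero of the affine form, a small step against its gradient [(k, l)] makes the form
    negative and so leaves [A]. *)
Lemma interior_affine_neq0 (k l m : R) A x :
  (k, l) <> (0, 0) -> (forall y, A y -> 0 <= k * y.1 + l * y.2 + m) ->
  k * x.1 + l * x.2 + m = 0 -> ~ interior A x.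
Proof.
move=> kl0 HA gx Ax.
have : (fun t : R => (x.1 - t * k, x.2 - t * l)) @ (0 : R) --> x.
  rewrite [X in _ --> X](_ : x = (x.1 - 0 * k, x.2 - 0 * l)); last first.
    by rewrite !mul0r !subr0 -surjective_pairing.
  have lin (u v : R) : (fun t : R => u - t * v) @ (0 : R) --> u - 0 * v.
    by apply: cvgB; [exact: cvg_cst|apply: cvgM; [exact: cvg_id|exact: cvg_cst]].
  exact: (cvg_pair (lin x.1 k) (lin x.2 l)).
move=> /(_ _ Ax) /nbhs_ballP[e /= e0 He].
have /He /HA /= : ball (0 : R) e (e / 2).
  by rewrite -ball_normE /= sub0r normrN gtr0_norm ?divr_gt0 // ltr_pdivrMr // ltr_pMr // ltr1n.
have -> : k * (x.1 - e / 2 * k) + l * (x.2 - e / 2 * l) + m =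
   (k * x.1 + l * x.2 + m) - e / 2 * (k ^+ 2 + l ^+ 2) by ring.
rewrite gx sub0r oppr_ge0 pmulr_rle0 ?divr_gt0 // => kl.
have k2 := sqr_ge0 k; have l2 := sqr_ge0 l.
apply: kl0; congr pair; apply/eqP; rewrite -sqrf_eq0; apply/eqP; lra.
Qed.

Lemma rdet_affine1 b c x :
  rdet x b c = (b.2 - c.2) * x.1 + (c.1 - b.1) * x.2 + (b.1 * c.2 - b.2 * c.1).
Proof. by rewrite /rdet; ring. Qed.

Lemma rdet_rot a b c : rdet a b c = rdet b c a.
Proof. by rewrite /rdet; ring. Qed.

(** Each condition is a half-plane containing the three vertices; the factor [rdet a b c] makes it
    independent of orientation. *)
Lemma rdet_convex_hull a b c x : convex_hull [set a; b; c] x ->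
  [/\ 0 <= rdet a b c * rdet x b c, 0 <= rdet a b c * rdet a x c &
      0 <= rdet a b c * rdet a b x].
Proof.
set D := rdet a b c => hx.
have aux p q : (forall z, [set a; b; c] z -> 0 <= D * rdet z p q) ->
    0 <= D * rdet x p q.
  move=> H; have := @convex_hull_halfplane (D * (p.2 - q.2)) (D * (q.1 - p.1))
    (D * (p.1 * q.2 - p.2 * q.1)) [set a; b; c] _ x hx.
  rewrite -!mulrA -!mulrDr -rdet_affine1; apply => z /H.
  by rewrite rdet_affine1; congr (_ <= _); ring.
have D2 : 0 <= D * D by rewrite -expr2 sqr_ge0.
have z1 p q : rdet p p q = 0 by rewrite /rdet; ring.
have z2 p q : rdet p q p = 0 by rewrite /rdet; ring.
split; [|rewrite rdet_rot|rewrite -rdet_rot]; apply: aux => z [[->|->]|->];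
  rewrite ?z1 ?z2 ?mulr0 //; rewrite -/D //.
- by rewrite -rdet_rot.
- by rewrite rdet_rot.
Qed.

Lemma barycentric_coordinates a b c x (D := rdet a b c) : D != 0 ->
  (rdet x b c / D * a.1 + rdet a x c / D * b.1 + rdet a b x / D * c.1,
   rdet x b c / D * a.2 + rdet a x c / D * b.2 + rdet a b x / D * c.2) = x.
Proof.
rewrite {}/D /rdet.
by case: x a b c => [x1 x2] [a1 a2] [b1 b2] [c1 c2] /= D0; congr pair; field.
Qed.

Lemma convex_hull_rdet a b c x : rdet a b c != 0 ->
  0 <= rdet a b c * rdet x b c -> 0 <= rdet a b c * rdet a x c ->
  0 <= rdet a b c * rdet a b x -> convex_hull [set a; b; c] x.
Proof.
set D := rdet a b c => D0 h1 h2 h3.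
have pos y : 0 <= D * y -> 0 <= y / D.
  by move=> Dy; rewrite -(@pmulr_rge0 _ (D ^+ 2)) ?exprn_even_gt0 // expr2 mulrACA mulfV // mulr1.
have := @convex_set_barycenter _ a b c _ _ _ (@convex_convex_hull [set a; b; c])
  _ _ _ (pos _ h1) (pos _ h2) (pos _ h3) _.
rewrite [X in _ -> _ -> _ -> _ -> convex_hull _ X](_ : _ = x); last first.
  exact: barycentric_coordinates.
apply; try by apply: sub_convex_hull => /=; tauto.
rewrite -!mulrDl (_ : _ + _ + _ = D) ?mulfV //.
by rewrite /D /rdet; ring.
Qed.

Lemma interior_convex_hull a b c x :
  0 < rdet a b c * rdet x b c -> 0 < rdet a b c * rdet a x c ->
  0 < rdet a b c * rdet a b x -> interior (convex_hull [set a; b; c]) x.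
Proof.
set D := rdet a b c => h1 h2 h3.
have aux p q : 0 < D * rdet x p q -> \forall y \near x, 0 <= D * rdet y p q.
  move=> H; have := @interior_affine_gt0 (D * (p.2 - q.2)) (D * (q.1 - p.1))
    (D * (p.1 * q.2 - p.2 * q.1)) x.
  rewrite -!mulrA -!mulrDr -rdet_affine1 => /(_ H); apply: filterS => y.
  by rewrite rdet_affine1; congr (_ <= _); ring.
have n1 := aux _ _ h1.
have n2 : \forall y \near x, 0 <= D * rdet a y c.
  by rewrite rdet_rot in h2; apply: filterS (aux _ _ h2) => y; rewrite [rdet a y c]rdet_rot.
have n3 : \forall y \near x, 0 <= D * rdet a b y.
  by rewrite -rdet_rot in h3; apply: filterS (aux _ _ h3) => y; rewrite rdet_rot.
have D0 : D != 0 by apply: contraTneq h1 => ->; rewrite mul0r ltxx.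
by apply: filterS (filterI n1 (filterI n2 n3)) => y [? [? ?]]; apply: convex_hull_rdet.
Qed.

(** The affine form [rdet a b c * rdet a b x] is nonnegative on the triangle and vanishes along the
    line [ab]. *)
Lemma rdet0_not_interior a b c x : rdet a b c != 0 -> rdet a b x = 0 ->
  ~ interior (convex_hull [set a; b; c]) x.
Proof.
set D := rdet a b c => D0 h0.
apply: (@interior_affine_neq0 (D * (a.2 - b.2)) (D * (b.1 - a.1))
    (D * (a.1 * b.2 - a.2 * b.1))).
- case=> /eqP + /eqP; rewrite !mulf_eq0 (negbTE D0) /= !subr_eq0 => /eqP e2 /eqP e1.
  by move: D0; rewrite /D /rdet e1 e2 !subrr !mul0r subrr eqxx.
- move=> y /rdet_convex_hull[_ _]; rewrite -/D -rdet_rot rdet_affine1.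
  by congr (_ <= _); ring.
- by rewrite -!mulrA -!mulrDr -rdet_affine1 rdet_rot h0 mulr0.
Qed.

End PlaneGeometry.

(** * Lattice triangles *)

Lemma card_set_seq (T : choiceType) (l : seq T) :
  uniq l -> ([set` l] #= `I_(size l))%card.
Proof.
move=> ul; have -> : [set` l] = [set` seq_fset tt l].
  by apply/seteqP; split=> x; rewrite /mkset (seq_fsetE tt l).
by apply/card_eq_fsetP; rewrite size_seq_fset undup_id.
Qed.

Lemma set_seqI (T : choiceType) (l : seq T) (S : set T) :
  [set` l] `&` S = [set` [seq x <- l | `[< S x >]]].
Proof.
apply/seteqP; split=> x /=; rewrite mem_filter.
  by case=> xl Sx; apply/andP; split; [exact/asboolP|].
by case/andP => /asboolP.
Qed.

Lemma card_set_seqI (T : choiceType) (l : seq T) (S : set T) k :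
  uniq l -> ([set` l] `&` S #= `I_k)%card <-> count (fun x => `[< S x >]) l = k.
Proof.
move=> ul; rewrite set_seqI -size_filter.
have := card_set_seq (filter_uniq (fun x => `[< S x >]) ul).
by move/card_eql => ->; split => [/card_eq_II|/card_eq_II].
Qed.

Lemma int_unimodular_coord (v1 v2 w1 w2 p q : int) : `|det2 v1 v2 w1 w2| = 1 ->
  exists i j : int, p = i * v1 + j * w1 /\ q = i * v2 + j * w2.
Proof.
set D := det2 v1 v2 w1 w2 => uni.
have DD : D * D = 1 by have [->|->] : D = 1 \/ D = -1 by lia.
exists (D * det2 p q w1 w2), (D * det2 v1 v2 p q); split.
- by transitivity (D * D * p); [rewrite DD mul1r|rewrite /D /det2; ring].
- by transitivity (D * D * q); [rewrite DD mul1r|rewrite /D /det2; ring].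
Qed.

Lemma tdetxx1 (p q : point) : tdet p p q = 0.
Proof. by rewrite /tdet /det2; ring. Qed.

Lemma tdetxx2 (p q : point) : tdet p q p = 0.
Proof. by rewrite /tdet /det2; ring. Qed.

Lemma tdetxx3 (p q : point) : tdet p q q = 0.
Proof. by rewrite /tdet /det2; ring. Qed.

Section LatticeTriangles.
Variable R : realType.
Implicit Types a b c p : point.

Lemma rdet_embed a b c : rdet (embed R a) (embed R b) (embed R c) = (tdet a b c)%:~R.
Proof. by rewrite /tdet /det2 rmorphB !rmorphM !rmorphB. Qed.

Lemma noncollinear_tdet a b c :
  ~ collinear (@real_vertices R a b c) <-> tdet a b c != 0.
Proof.
split=> [nc|].
  apply/negP => /eqP D0; apply: nc.
  have {}D0 : rdet (embed R a) (embed R b) (embed R c) = 0 by rewrite rdet_embed D0.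
  rewrite /collinear /real_vertices; move: D0.
  case: (embed R a) (embed R b) (embed R c) => [a1 a2] [b1 b2] [c1 c2].
  rewrite /rdet /= => D0.
  have line (u v : R) : (u, v) <> (0, 0) -> u * (b1 - a1) + v * (b2 - a2) = 0 ->
      u * (c1 - a1) + v * (c2 - a2) = 0 -> exists u v w : R, (u, v) <> (0, 0) /\
      [set (a1, a2); (b1, b2); (c1, c2)] `<=` [set p | u * p.1 + v * p.2 = w].
    move=> uv e1 e2; exists u, v, (u * a1 + v * a2); split=> //.
    by move=> x [[->|->]|->] //=; lra.
  have [ab|ab] := pselect (a2 - b2 = 0 /\ b1 - a1 = 0).
    have [ac|ac] := pselect (a2 - c2 = 0 /\ c1 - a1 = 0).
      apply: (line 1 0); [by case=> /eqP; rewrite oner_eq0|lra|lra].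
    apply: (line (a2 - c2) (c1 - a1)); [by case=> *; apply: ac|nra|ring].
  apply: (line (a2 - b2) (b1 - a1)); [by case=> *; apply: ab|ring|lra].
move=> D0 [u [v [w [uv H]]]].
have Ha : @real_vertices R a b c (embed R a) by left; left.
have Hb : @real_vertices R a b c (embed R b) by left; right.
have Hc : @real_vertices R a b c (embed R c) by right.
have := H _ Hc; have := H _ Hb; have := H _ Ha.
have {D0}: rdet (embed R a) (embed R b) (embed R c) != 0 by rewrite rdet_embed intr_eq0.
case: (embed R a) (embed R b) (embed R c) => [a1 a2] [b1 b2] [c1 c2].
rewrite /rdet /= => D0 ea eb ec; apply: uv.
set D := (X in X != 0) in D0.
(* Solving for the normal [(u, v)] by Cramer's rule: its products with both edge vectors vanish,
   since the form takes the value [w] at every vertex. *)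
have e1 : D * u = 0.
  have -> : D * u = (c2 - a2) * ((u * b1 + v * b2) - (u * a1 + v * a2)) -
      (b2 - a2) * ((u * c1 + v * c2) - (u * a1 + v * a2)) by rewrite /D; ring.
  by rewrite ea eb ec subrr !mulr0 subrr.
have e2 : D * v = 0.
  have -> : D * v = (b1 - a1) * ((u * c1 + v * c2) - (u * a1 + v * a2)) -
      (c1 - a1) * ((u * b1 + v * b2) - (u * a1 + v * a2)) by rewrite /D; ring.
  by rewrite ea eb ec subrr !mulr0 subrr.
by congr pair; apply/eqP; [move/eqP: e1|move/eqP: e2]; rewrite mulf_eq0 (negbTE D0).
Qed.

Lemma triangle_tdet a b c p : tdet a b c != 0 ->
  triangle R a b c p <->
  [/\ 0 <= tdet a b c * tdet p b c, 0 <= tdet a b c * tdet a p c &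
      0 <= tdet a b c * tdet a b p].
Proof.
move=> D0; rewrite -!(@ler0z R) !intrM -!rdet_embed; split.
  exact: rdet_convex_hull.
by case; apply: convex_hull_rdet; rewrite rdet_embed intr_eq0.
Qed.

Lemma triangle_uniq_vertices a b c : tdet a b c != 0 -> uniq [:: a; b; c].
Proof.
move=> D0; rewrite /= !inE andbT negb_or; apply/andP; split; [apply/andP; split|];
  apply: contraNneq D0 => ->; apply/eqP; rewrite /tdet /det2; ring.
Qed.

Lemma minimal_seq a b c p : tdet a b c != 0 -> uniq [:: a; b; c; p] ->
  triangle R a b c = [set` [:: a; b; c; p]] ->
  minimal R a b c /\ triangle R a b c `\` [set a; b; c] = [set p].
Proof.
move=> D0 up E; split; first split.
- exact/noncollinear_tdet.
- by rewrite E; apply: (card_set_seq up).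
rewrite E; apply/seteqP; split => x /=; rewrite !inE.
  by case=> /or4P[]/eqP-> h //; exfalso; apply: h; tauto.
move=> ->; rewrite eqxx !orbT; split=> //; move: up; rewrite /= !inE => up.
by case=> [[e|e]|e]; move: up; rewrite e eqxx ?orbT ?andbF ?andFb //=; rewrite ?andbF.
Qed.

(** In coordinates [i], [j] about [u] with axes [v], [w], the triangle is given by [i + j <= 1],
    [j - i <= 1] and [0 <= j], which have four integer solutions. *)
Lemma border_triangle_unimodular (u v w : point) :
  let l := [:: (u.1 - v.1, u.2 - v.2); (u.1 + v.1, u.2 + v.2); (u.1 + w.1, u.2 + w.2); u] in
  `|det2 v.1 v.2 w.1 w.2| = 1 -> uniq l /\ border_triangle R [set` l].
Proof.
case: u v w => [u1 u2] [v1 v2] [w1 w2] /=; set E := det2 v1 v2 w1 w2 => uni.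
set a := (u1 - v1, u2 - v2); set b := (u1 + v1, u2 + v2); set c := (u1 + w1, u2 + w2).
set u := (u1, u2).
have EE : E * E = 1 by have [->|->] : E = 1 \/ E = -1 by lia.
have DE : tdet a b c = 2 * E by rewrite /tdet /E /det2 /=; ring.
have D0 : tdet a b c != 0 by rewrite DE; lia.
have u1E : tdet u b c = E by rewrite /tdet /E /det2 /=; ring.
have u2E : tdet a u c = E by rewrite /tdet /E /det2 /=; ring.
have Du : tdet a b u = 0 by rewrite /tdet /det2 /=; ring.
have T : triangle R a b c = [set` [:: a; b; c; u]].
  apply/seteqP; split=> [[p q]|p] /=.
    have [i [j [pE qE]]] := int_unimodular_coord (p - u1) (q - u2) uni.
    have {pE}-> : p = u1 + i * v1 + j * w1 by rewrite -addrA -pE; ring.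
    have {qE}-> : q = u2 + i * v2 + j * w2 by rewrite -addrA -qE; ring.
    move/(triangle_tdet _ D0); rewrite DE.
    rewrite (_ : tdet (_, _) b c = (1 - i - j) * E); last by rewrite /tdet /E /det2 /=; ring.
    rewrite (_ : tdet a (_, _) c = (1 + i - j) * E); last by rewrite /tdet /E /det2 /=; ring.
    rewrite (_ : tdet a b (_, _) = 2 * j * E); last by rewrite /tdet /E /det2 /=; ring.
    have simp k : 2 * E * (k * E) = 2 * k * (E * E) by ring.
    rewrite !simp EE !mulr1 => -[h1 h2 h3].
    have [[-> ->]|[[-> ->]|[[-> ->]|[-> ->]]]] : (i = -1 /\ j = 0) \/ (i = 1 /\ j = 0) \/
       (i = 0 /\ j = 1) \/ (i = 0 /\ j = 0) by lia.
    - by rewrite inE; apply/orP; left; apply/eqP; congr pair; ring.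
    - by rewrite !inE; apply/or4P; apply: Or42; apply/eqP; congr pair; ring.
    - by rewrite !inE; apply/or4P; apply: Or43; apply/eqP; congr pair; ring.
    - by rewrite !inE; apply/or4P; apply: Or44; apply/eqP; congr pair; ring.
  have sq : 0 <= 2 * E * (2 * E) by rewrite -expr2 sqr_ge0.
  have sq' : 0 <= 2 * E * E by rewrite -mulrA EE.
  rewrite !inE => /or4P[]/eqP->; apply/triangle_tdet => //; rewrite DE; split;
    by rewrite ?tdetxx1 ?tdetxx2 ?tdetxx3 ?u1E ?u2E ?Du ?DE ?mulr0.
have up : uniq [:: a; b; c; u].
  have := triangle_uniq_vertices D0; rewrite /= !inE !negb_or => /and3P[/andP[-> ->] -> _] /=.
  have En0 : E <> 0 by lia.
  rewrite andbT; apply/and3P; split; apply/negP => /eqP e; apply: En0.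
  - by rewrite -u2E e tdetxx1.
  - by rewrite -u1E e tdetxx1.
  - by rewrite -u1E e tdetxx2.
have [m d] := minimal_seq D0 up T.
split => //; exists a, b, c; split => //; exists u; first by rewrite -T.
split.
  apply: subset_closure; suff : triangle R a b c u by [].
  by rewrite T /= !inE eqxx !orbT.
apply: rdet0_not_interior; rewrite rdet_embed ?intr_eq0 //.
by rewrite Du.
Qed.

(** In the same coordinates the conditions are [0 <= 1 + 2 * i - j], [0 <= 1 + 2 * j - i] and
    [i + j <= 1], again with four integer solutions; all three are strict at [u]. *)
Lemma internal_triangle_unimodular (u v w : point) :
  let l := [:: (u.1 + v.1, u.2 + v.2); (u.1 + w.1, u.2 + w.2); (u.1 - v.1 - w.1, u.2 - v.2 - w.2); u] in
  `|det2 v.1 v.2 w.1 w.2| = 1 -> uniq l /\ internal_triangle R [set` l].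
Proof.
case: u v w => [u1 u2] [v1 v2] [w1 w2] /=; set E := det2 v1 v2 w1 w2 => uni.
set a := (u1 + v1, u2 + v2); set b := (u1 + w1, u2 + w2).
set c := (u1 - v1 - w1, u2 - v2 - w2); set u := (u1, u2).
have EE : E * E = 1 by have [->|->] : E = 1 \/ E = -1 by lia.
have DE : tdet a b c = 3 * E by rewrite /tdet /E /det2 /=; ring.
have D0 : tdet a b c != 0 by rewrite DE; lia.
have u1E : tdet u b c = E by rewrite /tdet /E /det2 /=; ring.
have u2E : tdet a u c = E by rewrite /tdet /E /det2 /=; ring.
have u3E : tdet a b u = E by rewrite /tdet /E /det2 /=; ring.
have T : triangle R a b c = [set` [:: a; b; c; u]].
  apply/seteqP; split=> [[p q]|p] /=.
    have [i [j [pE qE]]] := int_unimodular_coord (p - u1) (q - u2) uni.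
    have {pE}-> : p = u1 + i * v1 + j * w1 by rewrite -addrA -pE; ring.
    have {qE}-> : q = u2 + i * v2 + j * w2 by rewrite -addrA -qE; ring.
    move/(triangle_tdet _ D0); rewrite DE.
    rewrite (_ : tdet (_, _) b c = (1 + 2 * i - j) * E); last by rewrite /tdet /E /det2 /=; ring.
    rewrite (_ : tdet a (_, _) c = (1 + 2 * j - i) * E); last by rewrite /tdet /E /det2 /=; ring.
    rewrite (_ : tdet a b (_, _) = (1 - i - j) * E); last by rewrite /tdet /E /det2 /=; ring.
    have simp k : 3 * E * (k * E) = 3 * k * (E * E) by ring.
    rewrite !simp EE !mulr1 => -[h1 h2 h3].
    have [[-> ->]|[[-> ->]|[[-> ->]|[-> ->]]]] : (i = 1 /\ j = 0) \/ (i = 0 /\ j = 1) \/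
       (i = -1 /\ j = -1) \/ (i = 0 /\ j = 0) by lia.
    - by rewrite inE; apply/orP; left; apply/eqP; congr pair; ring.
    - by rewrite !inE; apply/or4P; apply: Or42; apply/eqP; congr pair; ring.
    - by rewrite !inE; apply/or4P; apply: Or43; apply/eqP; congr pair; ring.
    - by rewrite !inE; apply/or4P; apply: Or44; apply/eqP; congr pair; ring.
  have sq : 0 <= 3 * E * (3 * E) by rewrite -expr2 sqr_ge0.
  have sq' : 0 <= 3 * E * E by rewrite -mulrA EE.
  rewrite !inE => /or4P[]/eqP->; apply/triangle_tdet => //; rewrite DE; split;
    by rewrite ?tdetxx1 ?tdetxx2 ?tdetxx3 ?u1E ?u2E ?u3E ?DE ?mulr0.
have up : uniq [:: a; b; c; u].
  have := triangle_uniq_vertices D0; rewrite /= !inE !negb_or => /and3P[/andP[-> ->] -> _] /=.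
  have En0 : E <> 0 by lia.
  rewrite andbT; apply/and3P; split; apply/negP => /eqP e; apply: En0.
  - by rewrite -u2E e tdetxx1.
  - by rewrite -u1E e tdetxx1.
  - by rewrite -u1E e tdetxx2.
have [m d] := minimal_seq D0 up T.
split => //; exists a, b, c; split => //; exists u; first by rewrite -T.
have pos : 0 < (tdet a b c)%:~R * E%:~R :> R.
  by rewrite -intrM DE ltr0z -mulrA EE.
by apply: interior_convex_hull; rewrite !rdet_embed ?u1E ?u2E ?u3E.
Qed.

Lemma B_stable_border_closed S : B_stable R S ->
  border_closed (fun x y => `[< S (x, y) >]).
Proof.
move=> BS a1 a2 b1 b2 c1 c2 d1 d2 e1 e2 uni.
have := @border_triangle_unimodular (b1, b2) (c1 - b1, c2 - b2) (d1 - b1, d2 - b2) uni.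
rewrite (_ : [:: _; _; _; _] = [:: (a1, a2); (c1, c2); (d1, d2); (b1, b2)]); last first.
  by congr [:: _; _; _; _]; congr pair => /=; lia.
case=> ul /BS; rewrite card_set_seqI //= => c3; apply/eqP => c3'; apply: c3.
by rewrite -c3'; lia.
Qed.

Lemma I_stable_internal_closed S : I_stable R S ->
  internal_closed (fun x y => `[< S (x, y) >]).
Proof.
move=> IS o1 o2 a1 a2 b1 b2 c1 c2 e1 e2 uni.
have := @internal_triangle_unimodular (o1, o2) (a1 - o1, a2 - o2) (b1 - o1, b2 - o2) uni.
rewrite (_ : [:: _; _; _; _] = [:: (a1, a2); (b1, b2); (c1, c2); (o1, o2)]); last first.
  by congr [:: _; _; _; _]; congr pair => /=; lia.
case=> ul /IS; rewrite card_set_seqI //= => c3; apply/eqP => c3'; apply: c3.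
by rewrite -c3'; lia.
Qed.

(** * Stability of the examples *)

Lemma triangle_rot a b c : triangle R a b c = triangle R b c a.
Proof.
rewrite /triangle /lattice_triangle; congr (_ @^-1` convex_hull _).
by apply/seteqP; split=> x; rewrite /real_vertices /=; tauto.
Qed.

Lemma triangle_midpoint a b c (x y m : point) :
  triangle R a b c x -> triangle R a b c y ->
  x.1 + y.1 = 2 * m.1 -> x.2 + y.2 = 2 * m.2 -> triangle R a b c m.
Proof.
move=> Tx Ty e1 e2; have h : 0 <= (1 / 2 : R) <= 1 by lra.
have /convex_setP/(_ _ _ _ h Tx Ty) := @convex_convex_hull R (real_vertices a b c).
have f1 : x.1%:~R + y.1%:~R = 2 * m.1%:~R :> R by rewrite -intrD e1 intrM.
have f2 : x.2%:~R + y.2%:~R = 2 * m.2%:~R :> R by rewrite -intrD e2 intrM.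
by rewrite /triangle /embed /=; congr (convex_hull _ _); congr pair; lra.
Qed.

(* Only convexity matters: the midpoints of three points of [2Z^2] are lattice
   points of the triangle, and at least two of them are new. *)
Lemma triangle_evens a b c S : minimal R a b c -> S `<=` evens `*` evens ->
  ~ (triangle R a b c `&` S #= `I_3)%card.
Proof.
move=> [_ c4] Sev c3.
have mid x y : (triangle R a b c `&` S) x -> (triangle R a b c `&` S) y ->
    exists2 m, triangle R a b c m & x.1 + y.1 = 2 * m.1 /\ x.2 + y.2 = 2 * m.2.
  move=> [Tx /Sev[/= [x1 _ ex1] [x2 _ ex2]]] [Ty /Sev[/= [y1 _ ey1] [y2 _ ey2]]].
  have e1 : x.1 + y.1 = 2 * (x1 + y1) by rewrite mulrDr ex1 ey1.
  have e2 : x.2 + y.2 = 2 * (x2 + y2) by rewrite mulrDr ex2 ey2.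
  by exists (x1 + y1, x2 + y2) => //; apply: (triangle_midpoint Tx Ty).
case/eq_cardSP: c3 => x Xx /eq_cardSP[y [Xy xy] /eq_cardSP[z [[Xz xz] yz] _]].
have [[m1 m2] Tm [em1 em2]] := mid _ _ Xx Xy.
have [[n1 n2] Tn [en1 en2]] := mid _ _ Xy Xz.
have [[p1 p2] Tp [ep1 ep2]] := mid _ _ Xx Xz.
case: x y z Xx Xy Xz xy xz yz em1 em2 en1 en2 ep1 ep2 =>
  [x1 x2] [y1 y2] [z1 z2] [Tx _] [Ty _] [Tz _] /= xy xz yz em1 em2 en1 en2 ep1 ep2.
have five (q r : point) : triangle R a b c q -> triangle R a b c r ->
   uniq [:: (x1, x2); (y1, y2); (z1, z2); q; r] -> False.
  move=> Tq Tr ul; suff : (5 <= 4)%N by [].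
  rewrite -card_le_II -(card_le_eqr c4) -(card_le_eql (card_set_seq ul)).
  apply: subset_card_le => w /=; rewrite !inE => /orP[/eqP->//|/or4P[]/eqP->//].
have xy' : ~~ ((x1 == y1) && (x2 == y2)) by apply/negP => /andP[/eqP e /eqP f]; apply: xy; rewrite e f.
have xz' : ~~ ((x1 == z1) && (x2 == z2)) by apply/negP => /andP[/eqP e /eqP f]; apply: xz; rewrite e f.
have yz' : ~~ ((y1 == z1) && (y2 == z2)) by apply/negP => /andP[/eqP e /eqP f]; apply: yz; rewrite e f.
(* At most one of the three points is the midpoint of the other two; the two remaining midpoints are
   then new and distinct. *)
have [/andP[/eqP h1 /eqP h2]|h] := boolP ((z1 == m1) && (z2 == m2)).
  by apply: (five _ _ Tn Tp); rewrite /= !inE !xpair_eqE; lia.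
have [/andP[/eqP h1 /eqP h2]|h'] := boolP ((x1 == n1) && (x2 == n2)).
  by apply: (five _ _ Tm Tp); rewrite /= !inE !xpair_eqE; lia.
by apply: (five _ _ Tm Tn); rewrite /= !inE !xpair_eqE; lia.
Qed.

(** A vertex is an extreme point: the barycentric coordinates of [x] and [y] at [b] and at [c] have
    one sign and cancel, so all of them vanish. *)
Lemma triangle_vertex_extreme a b c (x y : point) : tdet a b c != 0 ->
  triangle R a b c x -> triangle R a b c y ->
  x.1 + y.1 = 2 * a.1 -> x.2 + y.2 = 2 * a.2 -> x = y.
Proof.
move=> D0 /(triangle_tdet _ D0)[_ x2 x3] /(triangle_tdet _ D0)[_ y2 y3] e1 e2.
have s2 : tdet a x c + tdet a y c = 0.
  have -> : tdet a x c + tdet a y c = ((x.1 + y.1) - 2 * a.1) * (c.2 - a.2) -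
     ((x.2 + y.2) - 2 * a.2) * (c.1 - a.1) by rewrite /tdet /det2; ring.
  by rewrite e1 e2 !subrr !mul0r subrr.
have s3 : tdet a b x + tdet a b y = 0.
  have -> : tdet a b x + tdet a b y = (b.1 - a.1) * ((x.2 + y.2) - 2 * a.2) -
     (b.2 - a.2) * ((x.1 + y.1) - 2 * a.1) by rewrite /tdet /det2; ring.
  by rewrite e1 e2 !subrr !mulr0 subrr.
set D := tdet a b c in D0 x2 x3 y2 y3.
have zero (u v : int) : u + v = 0 -> 0 <= D * u -> 0 <= D * v -> u = 0.
  move=> /eqP; rewrite addr_eq0 => /eqP ->; rewrite mulrN oppr_ge0 => h1 h2.
  apply/eqP; rewrite oppr_eq0; have /eqP : D * v = 0 by apply/eqP; rewrite eq_le h1 h2.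
  by rewrite mulf_eq0 (negbTE D0).
have zx2 := zero _ _ s2 x2 y2; have zx3 := zero _ _ s3 x3 y3.
have q1 : D * (x.1 - a.1) = 0.
  have -> : D * (x.1 - a.1) = (b.1 - a.1) * tdet a x c + (c.1 - a.1) * tdet a b x.
    by rewrite /D /tdet /det2; ring.
  by rewrite zx2 zx3 !mulr0.
have q2 : D * (x.2 - a.2) = 0.
  have -> : D * (x.2 - a.2) = (b.2 - a.2) * tdet a x c + (c.2 - a.2) * tdet a b x.
    by rewrite /D /tdet /det2; ring.
  by rewrite zx2 zx3 !mulr0.
move: q1 q2 => /eqP; rewrite mulf_eq0 (negbTE D0) /= => /eqP q1 /eqP.
rewrite mulf_eq0 (negbTE D0) /= => /eqP q2.
by case: x y e1 e2 q1 q2 {x2 x3 y2 y3 s2 s3 zx2 zx3} => [? ?] [? ?] /= *; congr pair; lia.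
Qed.

Lemma internal_even_rows a b c p S : minimal R a b c ->
  triangle R a b c `\` [set a; b; c] = [set p] ->
  interior (lattice_triangle a b c) (embed R p) ->
  S `<=` [set: int] `*` evens -> ~ (triangle R a b c `&` S #= `I_3)%card.
Proof.
move=> [/noncollinear_tdet D0 _] Tp pint Sev.
have D0' : tdet b c a != 0 by move: D0; congr (_ != _); rewrite /tdet /det2; ring.
have D0'' : tdet c a b != 0 by move: D0; congr (_ != _); rewrite /tdet /det2; ring.
have edge u v w : tdet u v w != 0 ->
    [set embed R u; embed R v; embed R w] = real_vertices a b c ->
    tdet u v p != 0.
  move=> Duvw E; apply/negP => /eqP e; move: pint; rewrite /lattice_triangle -E.
  by apply: rdet0_not_interior; rewrite rdet_embed ?intr_eq0 // e.
have e1 : tdet a b p != 0 by apply: (edge _ _ c).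
have e2 : tdet b c p != 0.
  by apply: (edge _ _ a) => //; apply/seteqP; split=> x; rewrite /real_vertices /=; tauto.
have e3 : tdet c a p != 0.
  by apply: (edge _ _ b) => //; apply/seteqP; split=> x; rewrite /real_vertices /=; tauto.
(* A lattice midpoint is one of the four points. At a vertex, extremality gives [x = y]. At the
   centre [p], either [x] or [y] is [p] and they coincide, or both are vertices; distinct vertices
   would put [p] on an edge. *)
have midpoint x y m : triangle R a b c x -> triangle R a b c y ->
    x.1 + y.1 = 2 * m.1 -> x.2 + y.2 = 2 * m.2 -> x = y.
  move=> Tx Ty f1 f2; have Tm := triangle_midpoint Tx Ty f1 f2.
  have [ma|ma] := pselect (m = a).
    by subst m; apply: (triangle_vertex_extreme D0 Tx Ty).
  have [mb|mb] := pselect (m = b).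
    by subst m; rewrite triangle_rot in Tx Ty; apply: (triangle_vertex_extreme D0' Tx Ty).
  have [mc|mc] := pselect (m = c).
    by subst m; rewrite -triangle_rot in Tx Ty; apply: (triangle_vertex_extreme D0'' Tx Ty).
  have mp : m = p.
    by suff : [set p] m by []; rewrite -Tp; split => // -[[]|].
  subst m; have vertex z : triangle R a b c z -> z = p \/ [set a; b; c] z.
    move=> Tz; have [?|nz] := pselect ([set a; b; c] z); [by right|left].
    by suff : [set p] z by []; rewrite -Tp.
  have col : tdet x y p = 0.
    have xE : x = (2 * p.1 - y.1, 2 * p.2 - y.2).
      by case: (x) f1 f2 => x1 x2 /= f1 f2; congr pair; lia.
    by rewrite xE /tdet /det2 /=; ring.
  have col' : tdet y x p = 0.
    by move: col; rewrite -[in _ -> _](oppr0) => /(congr1 -%R); rewrite oppr0 => <-;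
      rewrite /tdet /det2; ring.
  have [xp|vx] := vertex x Tx.
    by move: f1 f2; rewrite xp; case: (p) (y) => [? ?] [? ?] /= *; congr pair; lia.
  have [yp|vy] := vertex y Ty.
    by move: f1 f2; rewrite yp; case: (p) (x) => [? ?] [? ?] /= *; congr pair; lia.
  case: vx vy => [[xv|xv]|xv] [[yv|yv]|yv]; rewrite xv yv // in col col' *; exfalso.
  - by rewrite col eqxx in e1.
  - by rewrite col' eqxx in e3.
  - by rewrite col' eqxx in e1.
  - by rewrite col eqxx in e2.
  - by rewrite col eqxx in e3.
  - by rewrite col' eqxx in e2.
case/eq_cardSP => x [Tx /Sev[_ /= [x2 _ ex]]].
case/eq_cardSP => y [[Ty /Sev[_ /= [y2 _ ey]]] xy].
case/eq_cardSP => z [[[Tz /Sev[_ /= [z2 _ ez]]] xz] yz] _.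
(* Second coordinates are already even, so equal parity of the first coordinates yields a lattice
   midpoint; among three points two agree in parity. *)
have par u v u2 v2 : triangle R a b c u -> triangle R a b c v ->
    2 * u2 = u.2 -> 2 * v2 = v.2 -> (2 %| u.1 + v.1)%Z -> u = v.
  move=> Tu Tv eu ev d; apply: (@midpoint u v (((u.1 + v.1) %/ 2)%Z, u2 + v2)) => //=; lia.
have [d|d] := boolP (2 %| x.1 + y.1)%Z; first exact: xy (esym (par _ _ _ _ Tx Ty ex ey d)).
have [d'|d'] := boolP (2 %| y.1 + z.1)%Z; first exact: yz (esym (par _ _ _ _ Ty Tz ey ez d')).
by apply: xz; apply: esym; apply: (par _ _ _ _ Tx Tz ex ez); lia.
Qed.

Lemma BI_stable_evens S : S `<=` evens `*` evens -> BI_stable R S.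
Proof.
by move=> Sev; split=> T [a [b [c [m -> _]]]]; exact: triangle_evens.
Qed.

Lemma I_stable_even_rows S : S `<=` [set: int] `*` evens -> I_stable R S.
Proof.
move=> Sev T [a [b [c [m -> [p Tp pint]]]]]; exact: internal_even_rows Tp pint Sev.
Qed.

End LatticeTriangles.

(** * Densities *)

Section Density.
Variable R : realType.
Implicit Type S : set point.

Definition box_seq (n : nat) : seq point :=
  [seq (i%:Z - n%:Z, j%:Z - n%:Z) | i <- iota 0 n.*2.+1, j <- iota 0 n.*2.+1].

Lemma box_seq_uniq n : uniq (box_seq n).
Proof.
apply: allpairs_uniq; rewrite ?iota_uniq // => -[i j] [k l] _ _ /= [e1 e2].
by congr pair; lia.
Qed.

Lemma box_box_seq n : box n = [set` box_seq n].
Proof.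
apply/seteqP; split=> -[x y]; rewrite /box /= !in_itv /=.
  move=> [/andP[x1 x2] /andP[y1 y2]]; apply/allpairsP.
  exists (`|(x + n%:Z)%R|%N, `|(y + n%:Z)%R|%N); rewrite !mem_iota.
  by split=> /=; [lia|lia|congr pair; lia].
by case/allpairsP => -[i j]; rewrite !mem_iota => -[/= hi hj [-> ->]]; lia.
Qed.

Lemma card_box S n : #|` fset_set (S `&` box n)| =
  box_sum (fun x y => `[< S (x, y) >]) n.
Proof.
rewrite setIC box_box_seq.
have /card_fset_set -> : ([set` box_seq n] `&` S #=
    `I_(count (fun z => `[< S z >]) (box_seq n)))%card.
  by apply/card_set_seqI => //; exact: box_seq_uniq.
rewrite -sum1_count big_mkcond /box_seq big_allpairs_dep /box_sum.
have -> : iota 0 n.*2.+1 = index_iota 0 n.*2.+1 by rewrite /index_iota subn0.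
rewrite big_mkord; apply: eq_bigr => i _; rewrite big_mkord; apply: eq_bigr => j _.
by case: asbool.
Qed.

Lemma card_box_full n : #|` fset_set (box n)| = (n.*2.+1 * n.*2.+1)%N.
Proof.
rewrite -[box n]setTI card_box -[RHS]mul1n -box_sum_cst.
by apply: eq_bigr => i _; apply: eq_bigr => j _; rewrite asboolT.
Qed.

(** An error linear in the side of the box becomes of order [harmonic n] after division by its area,
    and the convergent bound [v] then dominates the upper limit. *)
Lemma limn_esup_le_harmonic (u : nat -> R) (d C : R) :
  (forall n, u n <= d + C * harmonic n) ->
  (limn_esup (fun n => (u n)%:E) <= d%:E)%E.
Proof.
move=> ub; pose v n := d + C * harmonic n.
have vd : (fun n => (v n)%:E) @ \oo --> d%:E.
  apply: cvg_EFin; first by apply: nearW.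
  rewrite -[d]addr0 -(mulr0 C).
  by apply: cvgD; [exact: cvg_cst|apply: cvgM; [exact: cvg_cst|exact: cvg_harmonic]].
rewrite -(cvg_limn_einf_sup vd).2 !limn_esup_lim.
apply: lee_lim; [exact: is_cvg_esups|exact: is_cvg_esups|apply: nearW => n].
apply: ge_ereal_sup => _ [k /= nk <-].
apply: (@le_trans _ _ (v k)%:E); first by rewrite lee_fin ub.
by apply: ereal_sup_ubound; exists k.
Qed.

Lemma limn_esup_eq_harmonic (u : nat -> R) (d C : R) :
  (forall n, `|u n - d| <= C * harmonic n) ->
  limn_esup (fun n => (u n)%:E) = d%:E.
Proof.
move=> ub; suff ud : (fun n => (u n)%:E) @ \oo --> d%:E.
  exact: (cvg_limn_einf_sup ud).2.
apply: cvg_EFin; first by apply: nearW.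
have lim (e : R) : (fun n => d + e * harmonic n) @ \oo --> d.
  rewrite -[X in _ --> X]addr0 -(mulr0 e).
  by apply: cvgD; [exact: cvg_cst|apply: cvgM; [exact: cvg_cst|exact: cvg_harmonic]].
apply: (squeeze_cvgr _ (lim (- C)) (lim C)); apply: nearW => n.
move: (ub n); rewrite /harmonic /=; move: (_^-1) => h; rewrite ler_norml => /andP[h1 h2].
by apply/andP; split; lra.
Qed.

Lemma harmonic_box (n : nat) : (n.*2.+1%:R)^-1 <= harmonic n :> R.
Proof. by rewrite lef_pV2 ?posrE ?ltr0n // ler_nat; lia. Qed.

Lemma upper_density_le S (k C : nat) : (0 < k)%N ->
  (forall n, k * box_sum (fun x y => `[< S (x, y) >]) n <=
     n.*2.+1 * n.*2.+1 + C * n.*2.+1)%N ->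
  (upper_density R S <= (1 / k%:R)%:E)%E.
Proof.
move=> k0 H; apply: (@limn_esup_le_harmonic _ _ C%:R) => n.
rewrite card_box card_box_full; have := H n; set b := box_sum _ _.
set M := n.*2.+1 => Hb.
have M0 : 0 < M%:R :> R by rewrite ltr0n.
have K0 : 0 < k%:R :> R by rewrite ltr0n.
have K1 : 1 <= k%:R :> R by rewrite ler1n.
have Hb' : k%:R * b%:R <= M%:R * M%:R + C%:R * M%:R :> R.
  by rewrite -!natrM -natrD ler_nat.
apply: (@le_trans _ _ (1 / k%:R + C%:R * M%:R^-1)); last first.
  by rewrite lerD2l ler_wpM2l // harmonic_box.
rewrite natrM ler_pdivrMr ?mulr_gt0 // -(ler_pM2l K0).
apply: le_trans Hb' _.
have -> : k%:R * ((1 / k%:R + C%:R / M%:R) * (M%:R * M%:R)) =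
   M%:R * M%:R + k%:R * (C%:R * M%:R) :> R by field; rewrite !gt_eqF.
by rewrite lerD2l ler_peMl // mulr_ge0.
Qed.

Lemma upper_density_eq S (d C : R) : 0 <= C ->
  (forall n, `|(box_sum (fun x y => `[< S (x, y) >]) n)%:R -
     d * (n.*2.+1%:R * n.*2.+1%:R)| <= C * n.*2.+1%:R) ->
  upper_density R S = d%:E.
Proof.
move=> C0 H; apply: (@limn_esup_eq_harmonic _ _ C) => n.
rewrite card_box card_box_full; have := H n; set b := box_sum _ _.
set M := n.*2.+1 => Hb.
have M0 : 0 < M%:R :> R by rewrite ltr0n.
apply: (@le_trans _ _ (C * M%:R^-1)); last by rewrite ler_wpM2l // harmonic_box.
rewrite natrM -(ler_pM2r (mulr_gt0 M0 M0)) -[X in _ * X <= _](gtr0_norm (mulr_gt0 M0 M0)).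
rewrite -normrM mulrBl divfK ?mulf_neq0 ?gt_eqF //.
by apply: le_trans Hb _; rewrite -mulrA mulKf // gt_eqF.
Qed.

(** * Sets of prescribed density *)

Definition jump (F : int -> int) (x : int) : bool := F (x + 1) != F x.

(** Since [F] grows by 0 or 1, [jump F] is its increment and the sum telescopes. For
    [F x = floor (alpha x)] the jumps form a Beatty set. *)
Lemma sum_jump (F : int -> int) (M : nat) (c : int) :
  (forall x, F x <= F (x + 1) <= F x + 1) ->
  (\sum_(i < M) jump F (i%:Z + c)%R)%N%:Z = F (M%:Z + c) - F c.
Proof.
move=> HF; elim: M => [|M IH]; first by rewrite big_ord0 add0r subrr.
rewrite big_ord_recr /= PoszD IH /jump.
have -> : M.+1%:Z + c = M%:Z + c + 1 by lia.
by have := HF (M%:Z + c); lia.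
Qed.

(** The box count of a product set is the product of two window counts, each within 4 of its
    expected value because both ends of the window contribute an error of at most 2. *)
Lemma upper_density_jump (F G : int -> int) (al be : R) :
  0 <= al <= 1 ->
  (forall x, F x <= F (x + 1) <= F x + 1) ->
  (forall x, G x <= G (x + 1) <= G x + 1) ->
  (forall x, `|(F x)%:~R - al * x%:~R| <= 2) ->
  (forall x, `|(G x)%:~R - be * x%:~R| <= 2) ->
  upper_density R [set z | jump F z.1 && jump G z.2] = (al * be)%:E.
Proof.
move=> /andP[al0 al1] HF HG Fal Gbe; apply: (@upper_density_eq _ _ 8) => // n.
set M := n.*2.+1.
pose P H := (\sum_(i < M) jump H (i%:Z - n%:Z)%R)%N.
have -> : box_sum (fun x y => `[< [set z | jump F z.1 && jump G z.2] (x, y) >]) n =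
    (P F * P G)%N.
  rewrite /P big_distrlr /=; apply: eq_bigr => i _; apply: eq_bigr => j _.
  by rewrite /= asboolb -mulnb.
have PM H : (P H <= M)%N.
  rewrite /P -[X in (_ <= X)%N]card_ord -sum1_card; apply: leq_sum => i _.
  by case: (jump _ _).
have est H (ga : R) : (forall x, H x <= H (x + 1) <= H x + 1) ->
    (forall x, `|(H x)%:~R - ga * x%:~R| <= 2) -> `|(P H)%:R - ga * M%:R| <= 4.
  move=> HH Hga; have E : (P H)%:R = (H (M%:Z - n%:Z))%:~R - (H (- n%:Z))%:~R :> R.
    by rewrite -intrB -sum_jump // -/(P H).
  have h1 := Hga (M%:Z - n%:Z); have h2 := Hga (- n%:Z).
  rewrite intrB in h1; rewrite E -[M%:R]/(M%:~R).
  move: h1 h2; rewrite rmorphN /= !ler_norml => /andP[? ?] /andP[? ?].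
  by apply/andP; split; lra.
have := est F al HF Fal; have := est G be HG Gbe.
have F0 : 0 <= (P F)%:R :> R by []. have G0 : 0 <= (P G)%:R :> R by [].
have GM : (P G)%:R <= M%:R :> R by rewrite ler_nat PM.
have M0 : 0 <= M%:R :> R by [].
rewrite natrM; move: ((P F)%:R) ((P G)%:R) (M%:R) F0 G0 GM M0 => p q m p0 q0 qm m0 hq hp.
(* Each summand is at most [4 * m], by [q <= m] and [al <= 1]; hence the constant 8. *)
have -> : p * q - al * be * (m * m) = (p - al * m) * q + al * m * (q - be * m) by ring.
apply: le_trans (ler_normD _ _) _; rewrite !normrM (ger0_norm q0) (ger0_norm m0) (ger0_norm al0).
have h1 : `|p - al * m| * q <= 4 * m by apply: ler_pM.
have h2 : al * m * `|q - be * m| <= m * 4.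
  by apply: ler_pM => //; rewrite ?mulr_ge0 // ler_piMl.
lra.
Qed.

(** The ceiling of [x / 2]; unlike the floor, it jumps at the even integers. *)
Definition half_up (x : int) : int := ((x + 1) %/ 2)%Z.

Lemma half_up_step x : half_up x <= half_up (x + 1) <= half_up x + 1.
Proof. by rewrite /half_up; lia. Qed.

Lemma half_up_approx x : `|(half_up x)%:~R - 1 / 2 * x%:~R| <= 1 :> R.
Proof.
have : x <= 2 * half_up x <= x + 1 by rewrite /half_up; lia.
case/andP => h1 h2; rewrite ler_norml.
rewrite -(ler_int R) intrM in h1; rewrite -(ler_int R) intrM intrD in h2.
by apply/andP; split; lra.
Qed.

Lemma jump_half_up x : jump half_up x -> evens x.
Proof. by rewrite /jump /half_up => h; exists (x %/ 2)%Z => //; lia. Qed.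

Lemma floor_step (al x : R) : 0 <= al <= 1 ->
  Num.floor x <= Num.floor (x + al) <= Num.floor x + 1.
Proof.
case/andP => al0 al1; apply/andP; split; first by rewrite le_floor // lerDl.
by rewrite -ltzD1 floor_lt_int intrD [(_ + 1)%:~R]intrD;
  have := floorD1_gt x; rewrite intrD; lra.
Qed.

Lemma floor_approx (x : R) : `|(Num.floor x)%:~R - x| <= 1.
Proof.
have := floor_le x; have := floorD1_gt x; rewrite intrD ler_norml => h1 h2.
by apply/andP; split; lra.
Qed.

Lemma even_rows_density (d : R) : 0 <= d <= 1 / 2 ->
  exists2 S, S `<=` [set: int] `*` evens & upper_density R S = d%:E.
Proof.
(* A Beatty set of density [2 * d] is placed in every even row. *)
move=> d01; pose F (x : int) := Num.floor (2 * d * x%:~R).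
have al01 : 0 <= 2 * d <= 1 by lra.
exists [set z | jump F z.1 && jump half_up z.2].
  by move=> [x y] /= /andP[_ /jump_half_up].
rewrite (@upper_density_jump F half_up (2 * d) (1 / 2)) //.
- by congr EFin; lra.
- by move=> x; rewrite /F intrD mulrDr mulr1 floor_step.
- exact: half_up_step.
- by move=> x; apply: le_trans (floor_approx _) _; rewrite ler1n.
- by move=> x; apply: le_trans (half_up_approx _) _; rewrite ler1n.
Qed.

Lemma evens_density (d : R) : 0 <= d <= 1 / 4 ->
  exists2 S, S `<=` evens `*` evens & upper_density R S = d%:E.
Proof.
(* Composing with [half_up] leaves jumps at even [x] only and halves the slope [4 * d], so the
   factors have densities [2 * d] and [1 / 2]. *)
move=> d01; pose F (x : int) := Num.floor (4 * d * (half_up x)%:~R).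
have al01 : 0 <= 4 * d <= 1 by lra.
exists [set z | jump F z.1 && jump half_up z.2].
  move=> [x y] /= /andP[Fx /jump_half_up ?]; split=> //; apply: jump_half_up.
  by apply: contraNneq Fx => e; rewrite /F e.
rewrite (@upper_density_jump F half_up (2 * d) (1 / 2)) //.
- by congr EFin; lra.
- lra.
- move=> x; rewrite /F.
  have [->|->] : half_up (x + 1) = half_up x \/ half_up (x + 1) = half_up x + 1.
    by have := half_up_step x; lia.
  + by rewrite lexx lerDl.
  + by rewrite intrD mulrDr mulr1 floor_step.
- exact: half_up_step.
(* The floor contributes an error of at most 1, and [half_up] at most [4 * d <= 1]. *)
- move=> x; have := floor_approx (4 * d * (half_up x)%:~R); have := half_up_approx x.
  rewrite -/(F x) !ler_norml => /andP[h1 h2] /andP[h3 h4].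
  have [d0 d1] : 0 <= d /\ d <= 1 / 4 by lra.
  apply/andP; split; nra.
- by move=> x; apply: le_trans (half_up_approx _) _; rewrite ler1n.
Qed.

End Density.

Lemma proper_not_full (S : set point) : S `<` [set: point] ->
  ~ (forall x y, `[< S (x, y) >]).
Proof. by move=> [_ nS] full; apply: nS => -[x y] _; exact/asboolP. Qed.

Theorem theorem1p1 (R : realType) :
  ((forall S : set point, S `<` [set: point] ->
      B_stable R S -> (upper_density R S <= (1 / 4)%:E)%E) /\
   (forall d : R, 0 <= d <= 1 / 4 ->
      exists S : set point, BI_stable R S /\ upper_density R S = d%:E) /\
   (forall S : set point, S `<=` evens `*` evens -> BI_stable R S)) /\
  ((forall S : set point, S `<` [set: point] ->
      I_stable R S -> (upper_density R S <= (1 / 2)%:E)%E) /\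
   (forall d : R, 0 <= d <= 1 / 2 ->
      exists S : set point, I_stable R S /\ upper_density R S = d%:E) /\
   (forall S : set point, S `<=` [set: int] `*` evens -> I_stable R S)).
Proof.
split; split.
- move=> S /proper_not_full nfull /B_stable_border_closed bs.
  have [C HC] := border_closed_box_sum bs nfull.
  exact: (@upper_density_le R S 4 C).
- split=> [d /evens_density[S /(BI_stable_evens R) BI dS]|S]; first by exists S.
  exact: BI_stable_evens.
- move=> S /proper_not_full nfull /I_stable_internal_closed is_.
  have [C HC] := internal_closed_box_sum is_ nfull.
  exact: (@upper_density_le R S 2 C).
- split=> [d /even_rows_density[S /(I_stable_even_rows (R := R)) I dS]|S]; first by exists S.
  exact: I_stable_even_rows.
Qed.
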